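(* Let $G$ be a countable sofic group and let $\Sigma=\{\sigma_i:G\to\mathrm{Sym}(d_i)\}_{i=1}^\infty$ be a sofic approximation sequence for $G$. Let $A$ be a nonempty finite set and consider the restriction of the left shift action of $G$ on $A^G$ to some closed $G$-invariant proper subset $X$ of $A^G$. Then $h_\Sigma(X,G)<\log|A|$.
   Context: **Sofic approximations.** $\mathrm{Sym}(d)$ is the permutation group of $\{1,\dots,d\}$. A sofic approximation sequence for a countable discrete group $G$ is a sequence of maps (not necessarily homomorphisms) $\sigma_i:G\to\mathrm{Sym}(d_i)$, $s\mapsto\sigma_{i,s}$, with $\lim_i d_i=\infty$, $\lim_i \frac1{d_i}|\{k:\sigma_{i,st}(k)=\sigma_{i,s}\sigma_{i,t}(k)\}|=1$ for all $s,t\in G$, and $\lim_i\frac1{d_i}|\{k:\sigma_{i,s}(k)\ne\sigma_{i,t}(k)\}|=1$ for all distinct $s,t\in G$. $G$ is sofic if maps with the last two properties exist. For a map $\sigma:G\to\mathrm{Sym}(d)$, $s\in G$ and $f\in\mathbb C^d\cong C(\{1,\dots,d\})$ put $\sigma_s(f)=f\circ\sigma_s^{-1}$; on $\mathbb C^d$, $\|f\|_2=(\frac1d\sum_k|f(k)|^2)^{1/2}$. For a pseudometric space $(Y,\rho)$ and $\varepsilon\ge0$, $N_\varepsilon(Y,\rho)$ is the maximal cardinality of a finite $\varepsilon$-separated subset of $Y$ (pairwise distances $>\varepsilon$). Convention: $\log 0=-\infty$. **Left shift.** $A^G$ has the product topology and $(sx)_t=x_{s^{-1}t}$. **Topological entropy.**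 Let $G$ act continuously on a compact metrizable space $X$; $\alpha_s(f)(x)=f(s^{-1}x)$ for $f\in C(X)$. $C_{\mathbb R}(X)$ denotes the real-valued continuous functions with the supremum norm. A sequence in $C(X)$ is dynamically generating if its image is not contained in any proper $G$-invariant unital $C^*$-subalgebra of $C(X)$. For a sequence $\mathcal S=\{p_n\}$ in the unit ball of $C_{\mathbb R}(X)$ put $\rho_{\mathcal S}(\varphi,\psi)=\sum_{n=1}^\infty2^{-n}\|\varphi(p_n)-\psi(p_n)\|_2$. For nonempty finite $F\subseteq G$, $\delta>0$ and $\sigma:G\to\mathrm{Sym}(d)$, $\mathrm{Hom}(\mathcal S,F,\delta,\sigma)$ is the set of unital (algebra) homomorphisms $\varphi:C(X)\to\mathbb C^d$ such that $\sum_{n=1}^\infty2^{-n}\|\varphi\circ\alpha_s(p_n)-\sigma_s\circ\varphi(p_n)\|_2<\delta$ for all $s\in F$. Define $h_\Sigma(\mathcal S)=\sup_{\varepsilon>0}\inf_F\inf_{\delta>0}\limsup_{i\to\infty}\frac1{d_i}\log N_\varepsilon(\mathrm{Hom}(\mathcal S,F,\delta,\sigma_i),\rho_{\mathcal S})$, $F$ ranging over nonempty finite subsets of $G$. The topological entropy $h_\Sigma(X,G)$ is the common value of $h_\Sigma(\mathcal S)$ over all dynamically generating sequences $\mathcal S$ in the unit ball of $C_{\mathbb R}(X)$ (this value does not depend on $\mathcal S$). *)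

(* Defs.v *)
From HB Require Import structures.
From mathcomp Require Import all_boot all_order all_algebra all_fingroup.
From mathcomp Require Import all_classical all_reals all_analysis.
From mathcomp Require Import complex.

Set Implicit Arguments.
Unset Strict Implicit.
Unset Printing Implicit Defensive.

Import Order.TTheory GRing.Theory Num.Theory.
Import numFieldNormedType.Exports.

Local Open Scope classical_set_scope.
Local Open Scope ring_scope.

(* Sequences, here and below, are indexed from 0 instead of 1. *)
Section Sofic.
Context {G : groupType} (R : realType).

Definition almost_multiplicative (d : nat -> nat)
    (sigma : forall i, G -> 'S_(d i)) : Prop :=
  forall s t : G,
    #|[pred k | sigma i (s * t)%g k == sigma i s (sigma i t k)]|%:R
      / (d i)%:R @[i --> \oo] --> (1 : R).

Definition almost_free (d : nat -> nat)
    (sigma : forall i, G -> 'S_(d i)) : Prop :=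
  forall s t : G, s <> t ->
    #|[pred k | sigma i s k != sigma i t k]|%:R
      / (d i)%:R @[i --> \oo] --> (1 : R).

Definition sofic_approximation (d : nat -> nat)
    (sigma : forall i, G -> 'S_(d i)) : Prop :=
  [/\ d i @[i --> \oo] --> \oo,
      almost_multiplicative sigma & almost_free sigma].

End Sofic.

Definition sofic (G : groupType) (R : realType) : Prop :=
  exists (d : nat -> nat) (sigma : forall i, G -> 'S_(d i)),
    almost_multiplicative R sigma /\ almost_free R sigma.

(* R[i] has no canonical topology by default; this is the norm topology. *)
HB.instance Definition _ (R : realType) := NormedModule.copy R[i] R[i]^o.

(* C(X) *)
Definition cfun (X : topologicalType) (R : realType) := continuousType X R[i].

Section CFun.
Context {X : topologicalType} {R : realType}.
Implicit Types f g h : cfun X R.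

HB.instance Definition _ := Choice.on (cfun X R).

Definition cfun_mk (f : X -> R[i]) (cf : continuous f) : cfun X R := mkcts cf.

Definition cfun_eval f : X -> R[i] := f.
Coercion cfun_eval : cfun >-> Funclass.

Lemma cfunP f g : f =1 g -> f = g.
Proof. by move/continuousEP. Qed.

Lemma cfun_continuous f : continuous f.
Proof. exact: (@cts_fun X R[i] f). Qed.

Lemma cfun_cst_subproof (c : R[i]) : continuous (cst c : X -> R[i]).
Proof. exact: cst_continuous. Qed.

Lemma cfunD_subproof f g : continuous (f \+ g).
Proof. by move=> x; apply: continuousD; exact: cfun_continuous. Qed.

Lemma cfunN_subproof f : continuous (\- f).
Proof. by move=> x; apply: continuousN; exact: cfun_continuous. Qed.

Lemma cfunM_subproof f g : continuous (f \* g).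
Proof. by move=> x; apply: continuousM; exact: cfun_continuous. Qed.

Lemma cfunZ_subproof (c : R[i]) f : continuous (fun x => c * f x).
Proof.
by move=> x; apply: continuousM; [exact: cst_continuous | exact: cfun_continuous].
Qed.

Lemma cfun_conj_subproof f : continuous (fun x => (f x)^*%C).
Proof.
move=> x; apply/cvgrPdist_lt => e e0.
have /cvgrPdist_lt /(_ e e0) := @cfun_continuous f x.
by apply: filterS => y; rewrite -rmorphB normcJ.
Qed.

Definition cfun_cst c := cfun_mk (@cfun_cst_subproof c).
Definition cfun_add f g := cfun_mk (@cfunD_subproof f g).
Definition cfun_opp f := cfun_mk (@cfunN_subproof f).
Definition cfun_mul f g := cfun_mk (@cfunM_subproof f g).
Definition cfun_scale c f := cfun_mk (@cfunZ_subproof c f).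
Definition cfun_conj f := cfun_mk (@cfun_conj_subproof f).

Fact cfun_addA : associative cfun_add.
Proof. by move=> f g h; apply: cfunP => x; exact: addrA. Qed.
Fact cfun_addC : commutative cfun_add.
Proof. by move=> f g; apply: cfunP => x; exact: addrC. Qed.
Fact cfun_add0 : left_id (cfun_cst 0) cfun_add.
Proof. by move=> f; apply: cfunP => x; exact: add0r. Qed.
Fact cfun_addN : left_inverse (cfun_cst 0) cfun_opp cfun_add.
Proof. by move=> f; apply: cfunP => x; exact: addNr. Qed.

HB.instance Definition _ := GRing.isZmodule.Build (cfun X R)
  cfun_addA cfun_addC cfun_add0 cfun_addN.

Fact cfun_mulA : associative cfun_mul.
Proof. by move=> f g h; apply: cfunP => x; exact: mulrA. Qed.
Fact cfun_mulC : commutative cfun_mul.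
Proof. by move=> f g; apply: cfunP => x; exact: mulrC. Qed.
Fact cfun_mul1 : left_id (cfun_cst 1) cfun_mul.
Proof. by move=> f; apply: cfunP => x; exact: mul1r. Qed.
Fact cfun_mulDl : left_distributive cfun_mul cfun_add.
Proof. by move=> f g h; apply: cfunP => x; exact: mulrDl. Qed.

HB.instance Definition _ := GRing.Zmodule_isComPzRing.Build (cfun X R)
  cfun_mulA cfun_mulC cfun_mul1 cfun_mulDl.

Fact cfun_scaleA a b f : cfun_scale a (cfun_scale b f) = cfun_scale (a * b) f.
Proof. by apply: cfunP => x; exact: mulrA. Qed.
Fact cfun_scale1 : left_id 1 cfun_scale.
Proof. by move=> f; apply: cfunP => x; exact: mul1r. Qed.
Fact cfun_scaleDr : right_distributive cfun_scale +%R.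
Proof. by move=> c f g; apply: cfunP => x; exact: mulrDr. Qed.
Fact cfun_scaleDl f : {morph cfun_scale^~ f : a b / a + b}.
Proof. by move=> a b; apply: cfunP => x; exact: mulrDl. Qed.

HB.instance Definition _ := GRing.Zmodule_isLmodule.Build R[i] (cfun X R)
  cfun_scaleA cfun_scale1 cfun_scaleDr cfun_scaleDl.

(* Finite when X is compact; 0 when X is empty. *)
Definition sup_norm f : R := sup [set Normc.normc (f x) | x in [set: X]].

Record unital_Cstar_subalgebra (B : set (cfun X R)) : Prop := {
  Cstar_one : B 1;
  Cstar_linear : forall (c : R[i]) f g, B f -> B g -> B (c *: f + g);
  Cstar_mul : forall f g, B f -> B g -> B (f * g);
  Cstar_conj : forall f, B f -> B (cfun_conj f);
  Cstar_closed : forall f,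
    (forall e : R, 0 < e -> exists2 g, B g & sup_norm (f - g) < e) -> B f
}.

Definition real_unit_ball (p : nat -> cfun X R) : Prop :=
  forall n, (forall x, p n x \is Num.real) /\ sup_norm (p n) <= 1.

End CFun.

(* An action of the discrete group G by continuous maps. *)
Record cts_action (G : groupType) (X : topologicalType) := CtsAction {
  act :> G -> X -> X;
  act1 : forall x, act 1%g x = x;
  actM : forall s t x, act (s * t)%g x = act s (act t x);
  act_continuous : forall s, continuous (act s)
}.

(* C^d is the pointwise algebra 'I_d -> R[i]. *)
Section Cd.
Context {R : realType} {d : nat}.

Definition norm2 (f : 'I_d -> R[i]) : R :=
  Num.sqrt (d%:R^-1 * \sum_(k < d) Normc.normc (f k) ^+ 2).

Definition perm_act (s : 'S_d) (f : 'I_d -> R[i]) : 'I_d -> R[i] :=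
  fun k => f ((s^-1)%g k).

End Cd.

(* Maximal cardinality of a finite epsilon-separated subset of Y (+oo if
   there is no maximum). *)
Definition Nsep {R : realType} {T : Type} (eps : R) (Y : set T)
    (rho : T -> T -> \bar R) : \bar R :=
  ereal_sup [set n%:R%:E | n in [set n : nat |
    exists E : set T, [/\ E `<=` Y, (E #= `I_n)%card &
      forall x y, E x -> E y -> x <> y -> (eps%:E < rho x y)%E]]].

Section Entropy.
Context {R : realType} {G : groupType} {X : topologicalType}.
Variable a : cts_action G X.

Lemma alpha_subproof (s : G) (f : cfun X R) :
  continuous (fun x => f (a s^-1%g x)).
Proof.
by move=> x; apply: continuous_comp;
  [exact: act_continuous | exact: cfun_continuous].
Qed.

Definition alpha (s : G) (f : cfun X R) : cfun X R :=
  cfun_mk (@alpha_subproof s f).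

Definition dynamically_generating (p : nat -> cfun X R) : Prop :=
  forall B : set (cfun X R),
    unital_Cstar_subalgebra B ->
    (forall s f, B f -> B (alpha s f)) ->
    range p `<=` B -> B = [set: cfun X R].

Definition rho_seq (p : nat -> cfun X R) {d : nat}
    (phi psi : cfun X R -> ('I_d -> R[i])) : \bar R :=
  (\sum_(0 <= n <oo) (2^-1 ^+ n.+1 * norm2 (phi (p n) - psi (p n)))%:E)%E.

Definition approx_hom (p : nat -> cfun X R) (F : set G) (delta : R) {d : nat}
    (sigma : G -> 'S_d) : set (cfun X R -> ('I_d -> R[i])) :=
  [set phi : cfun X R -> ('I_d -> R[i]) | [/\ linear phi, monoid_morphism phi &
    forall s, F s ->
      (\sum_(0 <= n <oo) (2^-1 ^+ n.+1 *
         norm2 (phi (alpha s (p n)) - perm_act (sigma s) (phi (p n))))%:E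
       < delta%:E)%E]].

Context {d : nat -> nat} (sigma : forall i, G -> 'S_(d i)).

(* lne 0 = -oo *)
Definition entropy_seq (p : nat -> cfun X R) : \bar R :=
  ereal_sup [set
    ereal_inf [set
      ereal_inf [set
        limn_esup (fun i =>
          ((d i)%:R^-1)%:E * lne (Nsep eps (approx_hom p F delta (sigma i)) (rho_seq p)))%E
      | delta in [set delta : R | 0 < delta]]
    | F in [set F : set G | finite_set F /\ F !=set0]]
  | eps in [set eps : R | 0 < eps]].

Definition generator (p : nat -> cfun X R) : Prop :=
  real_unit_ball p /\ dynamically_generating p.

Definition common_entropy (h : \bar R) : Prop :=
  (exists p, generator p) /\ (forall p, generator p -> entropy_seq p = h).

(* The default value +oo is only taken if there is no common value; an upper
   bound on the entropy thus never holds by default. *)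
Definition topological_entropy : \bar R :=
  xget +oo%E [set h | common_entropy h].

End Entropy.

Lemma prod_continuous (T : topologicalType) (I : Type)
    (K : I -> topologicalType) (f : T -> prod_topology K) :
  (forall i, continuous (fun x => f x i)) -> continuous f.
Proof.
move=> cf x; apply/cvg_sup => i U.
rewrite (@nbhsE (initial_topology (fun g : prod_topology K => g i)) (f x)).
case=> B [[C oC <-] Ci] /filterS; apply.
by apply: (cf i x C); apply: open_nbhs_nbhs; split.
Qed.

Definition full_shift (G : groupType) (A : finType) : topologicalType :=
  prod_topology (fun _ : G => discrete_topology A).

Section Shift.
Context {G : groupType} {A : finType}.

Definition shift (s : G) (x : full_shift G A) : full_shift G A :=
  fun t => x (s^-1 * t)%g.

Definition shift_invariant (X : set (full_shift G A)) : Prop :=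
  forall s x, X x -> X (shift s x).

Lemma shift_continuous (s : G) : continuous (shift s).
Proof.
apply: (@prod_continuous _ _ (fun=> discrete_topology A)) => t.
exact: (@proj_continuous G (fun=> discrete_topology A) (s^-1 * t)%g).
Qed.

Section Subshift.
Variables (X : set (full_shift G A)) (invX : shift_invariant X).

Definition subshift_fun (s : G) (x : set_type X) : set_type X :=
  SigSub (mem_set (invX s (set_valP x))).

Fact subshift_fun1 x : subshift_fun 1%g x = x.
Proof.
by apply/val_inj/funext => t /=; rewrite /shift invg1 mul1g.
Qed.

Fact subshift_funM s t x :
  subshift_fun (s * t)%g x = subshift_fun s (subshift_fun t x).
Proof.
by apply/val_inj/funext => u /=; rewrite /shift invMg mulgA.
Qed.

Fact subshift_fun_continuous s : continuous (subshift_fun s).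
Proof.
apply/continuousP => B [C oC <-].
have -> : subshift_fun s @^-1` (set_val @^-1` C) =
  set_val @^-1` (shift s @^-1` C) by [].
apply: open_comp; first by move=> x _; exact: initial_continuous.
by apply: open_comp => // x _; exact: shift_continuous.
Qed.

(* The restriction of the left shift to X, with the subspace topology. *)
Definition subshift : cts_action G (set_type X) :=
  CtsAction subshift_fun1 subshift_funM subshift_fun_continuous.

End Subshift.

End Shift.

(* Main.v *)
Require Import Defs.
From HB Require Import structures.
From mathcomp Require Import all_boot all_order all_algebra all_fingroup.
From mathcomp Require Import all_classical all_reals all_analysis.
From mathcomp Require Import complex ring lra.

Set Implicit Arguments.
Unset Strict Implicit.
Unset Printing Implicit Defensive.

Import Order.TTheory GRing.Theory Num.Theory.
Import numFieldNormedType.Exports.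

Local Open Scope classical_set_scope.
Local Open Scope ring_scope.

(** Since X is compact, a unital homomorphism from C(X) to C^d is evaluation at
    a d-tuple x of points of X ([unital_hom_eval]). Under this dictionary
    [rho_seq] becomes a mean-square pseudometric [pdist] on tuples, and an
    approximately equivariant homomorphism becomes a tuple whose translate
    s^-1 x is close to the permuted tuple x o sigma_s^-1 ([microstate]). By
    Chebyshev's inequality, small [pdist] means that finitely many members of
    the sequence nearly agree on all but a small fraction of the d indices
    ([pdist_few], [few_pdist]).

    The entropy is a common value over all generating sequences, so it first
    has to be shown that it does not depend on the sequence. If p generates,
    then by compactness of X * X finitely many translates of finitely many p n
    control any given q m ([generating_control]). Hence microstates of p are
    microstates of q, because sigma is almost multiplicative
    ([microstate_transfer]), and separated tuples for q are separated for p
    ([pdist_control]). The two entropies thus bound each other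
    ([topological_entropyE]). This works for any action on a compact space.

    For a subshift the indicators of the symbols at the identity generate
    ([symbols_generator]), and for them a microstate matters only through its
    word w_k = x_k(1). If y lies outside X, compactness gives a finite set S
    such that no point of X agrees with y on S ([forbidden_pattern]). So the
    pattern of y on S occurs in w along few of the windows
    (sigma_s^-1 k), s in S. As sigma is almost free, a fixed proportion of the
    windows can be chosen injective and pairwise disjoint ([disjoint_windows]).
    If each word is weighted by exp(-number of occurrences in these windows), the
    total weight is at most |A|^d times one factor below 1 for each window, which
    bounds the number of words by exp(d (log|A| - c')) for some c' > 0
    ([card_few_occurs]). *)


(** * Compactness and characters *)

(** Compactness in terms of finite open subcovers, on spaces that need not have
    a distinguished point. *)
Lemma compact_subcover (X : topologicalType) (I : choiceType)
    (K : set X) (U : I -> set X) :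
  compact K -> (forall i, open (U i)) ->
  (forall x, K x -> exists i, U i x) ->
  exists s : seq I, forall x, K x -> exists2 i, i \in s & U i x.
Proof.
move=> /compact_near_coveringP Kc Uo Ucov.
pose B (s : seq I) : set (seq I) := [set t : seq I | {subset s <= t}].
pose F := filter_from [set: seq I] B.
have FF : Filter F.
  apply: filter_from_filter; first by exists [::].
  move=> s t _ _; exists (s ++ t) => // r /= rP.
  by split=> i ii; apply: rP; rewrite mem_cat ii ?orbT.
have [s _ sP] : \forall t \near F, K `<=` [set x | exists2 i, i \in (t : seq I) & U i x].
  apply: Kc => x /Ucov[i Uix].
  exists (U i, B [:: i]); first split=> /=.
  - exact: open_nbhs_nbhs.
  - by exists [:: i].
  - by move=> [y t] /= [Uy it]; exists i => //; apply: it; rewrite mem_head.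
by exists s; exact: (sP s).
Qed.

(* The norm of R[i] takes values in R[i]; Normc.normc is its real-valued form. *)
Section ComplexNorm.
Variable R : realType.
Implicit Types z w : R[i].
Notation nrm := Normc.normc.

Lemma normr_normc z : `|z| = (nrm z)%:C%C.
Proof. by rewrite normc_def; case: z => a b /=. Qed.

Lemma nrm_ge0 z : 0 <= nrm z.
Proof. by rewrite -(lecR 0) -normr_normc; exact: normr_ge0. Qed.

Lemma nrm0 : nrm (0 : R[i]) = 0.
Proof. exact: Normc.normc0. Qed.

Lemma nrm1 : nrm (1 : R[i]) = 1.
Proof. exact: Normc.normc1. Qed.

Lemma nrm_distC z w : nrm (z - w) = nrm (w - z).
Proof.
by have := distrC z w; rewrite !normr_normc => /(congr1 (@complex.Re R)).
Qed.

Lemma nrm_le_distD z w u : nrm (z - u) <= nrm (z - w) + nrm (w - u).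
Proof. by rewrite -lecR rmorphD -!normr_normc ler_distD. Qed.

Lemma nrm_leB z w : nrm (z - w) <= nrm z + nrm w.
Proof. by rewrite -lecR rmorphD -!normr_normc ler_normB. Qed.

Lemma nrm_eq0 z : (nrm z == 0) = (z == 0).
Proof.
by apply/eqP/eqP => [/Normc.eq0_normc|->] //; exact: nrm0.
Qed.

Lemma cvg_nrm (T : Type) (F : set_system T) (FF : Filter F) (f : T -> R[i]) z :
  f x @[x --> F] --> z -> (nrm (f x) : R) @[x --> F] --> nrm z.
Proof.
move=> fz; apply/cvgrPdist_lt => e e0.
have ec0 : 0 < e%:C%C by rewrite ltcR.
have /cvgrPdist_lt /(_ _ ec0) := fz.
apply: filterS => w; rewrite normr_normc ltcR; apply: le_lt_trans.
have h z' w' : nrm z' <= nrm (z' - w') + nrm w'.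
  by have := nrm_le_distD z' w' 0; rewrite !subr0.
have := h z (f w); have := h (f w) z; rewrite (nrm_distC (f w)) => h1 h2.
by rewrite ler_norml; apply/andP; split; lra.
Qed.

End ComplexNorm.

Section Characters.
Context {R : realType} {X : topologicalType}.
Notation nrm := Normc.normc.

Lemma cfun_dist_continuous (f : cfun X R) :
  continuous (fun z : X * X => nrm (f z.1 - f z.2) : R).
Proof.
move=> z; apply: cvg_nrm.
apply: cvgB.
  apply: (@continuous_comp _ _ _ fst (cfun_eval f)); first exact: cvg_fst.
  exact: cfun_continuous.
apply: (@continuous_comp _ _ _ snd (cfun_eval f)); first exact: cvg_snd.
exact: cfun_continuous.
Qed.

Lemma cfun_inv_subproof (f : cfun X R) :
  (forall x, f x != 0) -> continuous (fun x => (f x)^-1).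
Proof.
by move=> f0 x; apply: continuousV; [exact: f0|exact: cfun_continuous].
Qed.

Lemma cfun_sumE (I : Type) (s : seq I) (F : I -> cfun X R) x :
  (\sum_(i <- s) F i) x = \sum_(i <- s) F i x.
Proof. by elim/big_rec2: _ => // i y z _ <-. Qed.

(** On a compact space every unital algebra homomorphism to C^d is given by
    evaluation at d points. If no point x satisfied f x = phi f k for all f,
    finitely many f would witness this by compactness, and the sum of the
    |f - phi f k|^2 over them would be invertible but killed by phi at k. *)
Lemma unital_hom_eval (d : nat) (phi : cfun X R -> ('I_d -> R[i])) :
  compact [set: X] -> linear phi -> monoid_morphism phi ->
  exists x : 'I_d -> X, forall f k, phi f k = f (x k).
Proof.
move=> cX philin [phi1 phiM].
have phiD f g k : phi (f + g) k = phi f k + phi g k.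
  by have := congr1 (@^~ k) (philin 1 f g); rewrite !scale1r.
have phiMk f g k : phi (f * g) k = phi f k * phi g k by rewrite phiM.
have phi0 k : phi 0 k = 0.
  by apply: (addrI (phi 0 k)); rewrite -phiD !addr0.
have phiZ c f k : phi (c *: f) k = c * phi f k.
  have := congr1 (@^~ k) (philin c f 0); rewrite addr0 => ->.
  by transitivity (c * phi f k + phi 0 k); rewrite // phi0 addr0.
have phi_cst c k : phi (cfun_cst c) k = c.
  have -> : cfun_cst c = c *: (1 : cfun X R).
    by apply: cfunP => x; apply/esym; exact: mulr1.
  by rewrite phiZ phi1 mulr1.
suff H k : exists x, forall f, phi f k = f x.
  by case: (boolp.choice H) => x xP; exists x => f k; exact: xP.
apply: contrapT => nex.
pose U (f : cfun X R) := [set x | f x != phi f k].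
have Uo f : open (U f).
  have -> : U f = f @^-1` (~` [set phi f k]).
    by apply/seteqP; split=> x /= /eqP.
  apply: open_comp => [x _|]; first exact: cfun_continuous.
  apply: closed_openC; apply: accessible_closed_set1.
  by apply: hausdorff_accessible; exact: norm_hausdorff.
have [|s sP] := compact_subcover cX Uo.
  move=> x _; apply: contrapT => nf; apply: nex; exists x => f.
  by apply: contrapT => fx; apply: nf; exists f; apply/eqP => /esym.
pose T (f : cfun X R) := f + cfun_cst (- phi f k).
have T0 f : phi (T f) k = 0 by rewrite phiD phi_cst subrr.
pose g := \sum_(f <- s) cfun_conj (T f) * T f.
have g0 x : g x != 0.
  rewrite /g cfun_sumE; have [f fs Ufx] := sP x I.
  have E h : (cfun_conj (T h) * T h) x = `|h x - phi h k| ^+ 2.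
    by rewrite sqr_normc mulrC.
  rewrite (eq_bigr _ (fun h _ => E h)).
  rewrite psumr_eq0 => [|h _]; last exact: exprn_ge0.
  apply/allPn; exists f => //=.
  by rewrite expf_eq0 /= normr_eq0 subr_eq0.
have g1 : g * cfun_mk (cfun_inv_subproof g0) = 1.
  by apply: cfunP => x; exact: (mulfV (g0 x)).
have : phi g k = 0.
  rewrite /g; elim/big_rec: _ => // f y _ IH.
  by rewrite phiD IH phiMk T0 mulr0 addr0.
have : phi (g * cfun_mk (cfun_inv_subproof g0)) k = 1 by rewrite g1 phi1.
by rewrite phiMk => /[swap] ->; rewrite mul0r => /eqP; rewrite eq_sym oner_eq0.
Qed.

End Characters.

(** * Mean-square and counting distances *)

Section Few.
Context {R : realType}.

(** At most a fraction tau of the points of {0, ..., d-1} satisfy P. *)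
Definition few (d : nat) (tau : R) (P : 'I_d -> Prop) : Prop :=
  #|[pred k | `[< P k >]]|%:R <= tau * d%:R.

Variable d : nat.
Implicit Types (P Q : 'I_d -> Prop) (tau : R).

Lemma few_sub tau P Q : (forall k, P k -> Q k) -> few tau Q -> few tau P.
Proof.
move=> PQ; apply: le_trans; rewrite ler_nat; apply: subset_leq_card.
by apply/fintype.subsetP => k; rewrite !inE; exact: PQ.
Qed.

Lemma few_le tau tau' P : tau <= tau' -> few tau P -> few tau' P.
Proof. by move=> tt /le_trans; apply; rewrite ler_wpM2r. Qed.

Lemma few_or tau tau' P Q :
  few tau P -> few tau' Q -> few (tau + tau') (fun k => P k \/ Q k).
Proof.
rewrite /few => hP hQ; rewrite mulrDl; apply: le_trans (lerD hP hQ).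
rewrite -natrD ler_nat.
rewrite -cardUI; apply: leq_trans (leq_addr _ _); apply: subset_leq_card.
apply/fintype.subsetP => k.
rewrite !inE => -[h|h]; apply/orP; [left|right]; exact/asboolP.
Qed.

Lemma few_mem (I : eqType) (s : seq I) tau (P : I -> 'I_d -> Prop) :
  (forall i, i \in s -> few tau (P i)) ->
  few (tau *+ size s) (fun k => exists2 i, i \in s & P i k).
Proof.
elim: s => [_|i s IH h].
  rewrite /few mulr0n mul0r lern0; apply/eqP; apply: eq_card0 => k.
  by rewrite inE; apply/asboolP => -[].
rewrite /= mulrS; apply: few_sub (few_or (h i _) (IH _)).
- move=> k [j]; rewrite inE => /predU1P[->|js] Pj; first by left.
  by right; exists j.
- exact: mem_head.
- by move=> j js; apply: h; rewrite inE js orbT.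
Qed.

Lemma few_perm tau P (s : 'S_d) : few tau P -> few tau (fun k => P (s k)).
Proof.
apply: le_trans; rewrite ler_nat -(fintype.card_image (@perm_inj _ s)).
apply: subset_leq_card; apply/fintype.subsetP => j /fintype.imageP[k + ->].
by rewrite !inE.
Qed.

End Few.

Section Distances.
Context {R : realType} {X : topologicalType}.
Notation nrm := Normc.normc.
Implicit Types p q : nat -> cfun X R.

(** The pseudometric rho_seq p, read on the d-tuples of points at which two
    homomorphisms evaluate. *)
Definition pdist p (d : nat) (x y : 'I_d -> X) : \bar R :=
  (\sum_(0 <= n <oo)
    (2^-1 ^+ n.+1 * norm2 (fun k => p n (x k) - p n (y k)))%:E)%E.

(** Some p n with n < N distinguishes u from v by more than kappa. *)
Definition apart p (N : nat) (kappa : R) (u v : X) : Prop :=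
  exists2 n, (n < N)%N & kappa < nrm (p n u - p n v).

Lemma apart_trans p N kappa kappa' u v w :
  apart p N (kappa + kappa') u w -> apart p N kappa u v \/ apart p N kappa' v w.
Proof.
move=> [n nN kn]; have tri := nrm_le_distD (p n u) (p n v) (p n w).
have [h|h] := ltP kappa (nrm (p n u - p n v)); first by left; exists n.
have [h'|h'] := ltP kappa' (nrm (p n v - p n w)); first by right; exists n.
by move: kn tri h h'; lra.
Qed.

Lemma apart_sym p N kappa u v : apart p N kappa u v -> apart p N kappa v u.
Proof. by move=> [n nN]; rewrite nrm_distC => h; exists n. Qed.

Lemma norm2_ge0 d (f : 'I_d -> R[i]) : 0 <= norm2 f.
Proof. exact: sqrtr_ge0. Qed.

Lemma sqr_norm2 d (f : 'I_d -> R[i]) :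
  norm2 f ^+ 2 = d%:R^-1 * \sum_(k < d) nrm (f k) ^+ 2.
Proof.
by rewrite sqr_sqrtr // mulr_ge0 ?invr_ge0 // sumr_ge0 // => k _; exact: sqr_ge0.
Qed.

(** Chebyshev's inequality. *)
Lemma norm2_few d (f : 'I_d -> R[i]) (c kappa : R) :
  0 < kappa -> norm2 f <= c -> few ((c / kappa) ^+ 2) (fun k => kappa < nrm (f k)).
Proof.
move=> k0 fc; rewrite /few.
have [d0|d0] := posnP d.
  rewrite eq_card0; first by rewrite mulr_ge0 ?sqr_ge0.
  by move=> [k kd]; exfalso; move: kd; rewrite d0.
have dR : 0 < d%:R :> R by rewrite ltr0n.
have c0 : 0 <= c by apply: le_trans fc; exact: norm2_ge0.
have : norm2 f ^+ 2 <= c ^+ 2 by rewrite lerXn2r // nnegrE norm2_ge0.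
rewrite sqr_norm2 mulrC ler_pdivrMr // => /(le_trans _) h.
rewrite exprMn exprVn mulrAC ler_pdivlMr ?exprn_gt0 //; apply: h.
rewrite -sum1_card natr_sum mulr_suml [leRHS](bigID [pred k | `[< kappa < nrm (f k) >]]) /=.
rewrite -[leLHS]addr0; apply: lerD; last by apply: sumr_ge0 => k _; exact: sqr_ge0.
apply: ler_sum => k /asboolP kk; rewrite mul1r lerXn2r ?nnegrE ?nrm_ge0 ?ltW //.
Qed.

(** A function bounded by 2 and mostly below kappa has small mean square: the
    exceptional indices contribute at most 4 tau. *)
Lemma few_norm2 d (f : 'I_d -> R[i]) (tau kappa c : R) :
  0 <= tau -> 0 <= kappa -> 0 <= c -> kappa ^+ 2 + 4 * tau <= c ^+ 2 ->
  (forall k, nrm (f k) <= 2) -> few tau (fun k => kappa < nrm (f k)) ->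
  norm2 f <= c.
Proof.
move=> t0 k0 c0 ktc f2 ff.
rewrite -(@ler_pXn2r _ 2) ?nnegrE ?norm2_ge0 //; apply: le_trans ktc.
rewrite sqr_norm2.
have [d0|d0] := posnP d.
  by rewrite [X in X%:R]d0 invr0 mul0r addr_ge0 ?sqr_ge0 ?mulr_ge0.
have dR : 0 < d%:R :> R by rewrite ltr0n.
rewrite mulrC ler_pdivrMr // mulrDl.
rewrite (bigID [pred k | `[< kappa < nrm (f k) >]]) /= addrC; apply: lerD.
  apply: (@le_trans _ _ (\sum_(k < d) kappa ^+ 2)); last first.
    by rewrite sumr_const card_ord mulr_natr.
  rewrite big_mkcond /=; apply: ler_sum => k _.
  case: ifP => [/asboolP/negP|_]; last exact: sqr_ge0.
  by rewrite -leNgt => h; rewrite lerXn2r ?nnegrE ?nrm_ge0.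
rewrite -mulrA; apply: le_trans (ler_wpM2l _ ff); last by [].
rewrite -sum1_card natr_sum mulr_sumr; apply: ler_sum => k _.
by rewrite mulr1 (_ : 4 = 2 ^+ 2) ?lerXn2r ?nnegrE ?nrm_ge0 // -natrX.
Qed.

Lemma half_series (N : nat) (c : R) : 0 <= c ->
  (\sum_(N <= n <oo) (2^-1 ^+ n.+1 * c)%:E = (c * 2^-1 ^+ N)%:E)%E.
Proof.
move=> c0; rewrite -nneseries_addn; last first.
  by move=> i; rewrite lee_fin mulr_ge0 // exprn_ge0.
have := @cvg_geometric_eseries_half R c N.
rewrite exprVn => /cvg_lim <- //.
apply: congr_lim; apply/funext => n.
rewrite /eseries /=; apply: eq_bigr => i _.
by rewrite addnS natrX exprVn mulrC.
Qed.

Lemma pdist0 p d (x y : 'I_d -> X) :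
  (forall n k, p n (x k) = p n (y k)) -> pdist p x y = 0.
Proof.
move=> pxy; apply: eseries0 => n _ _.
rewrite (_ : norm2 _ = 0) ?mulr0 // /norm2.
rewrite big1 ?mulr0 ?sqrtr0 // => k _.
by rewrite pxy subrr nrm0 expr0n.
Qed.

(** Small mean-square distance forces near agreement at most indices. *)
Lemma pdist_few p : forall (N : nat) (kappa tau : R), 0 < kappa -> 0 < tau ->
  exists2 e : R, 0 < e & forall d (x y : 'I_d -> X),
    (pdist p x y <= e%:E)%E -> few tau (fun k => apart p N kappa (x k) (y k)).
Proof.
move=> N kappa tau k0 t0.
(* Each of the N coordinates may use up a fraction t^2 of the indices. *)
pose t := Num.sqrt (tau / N.+1%:R).
have tpos : 0 < t by rewrite sqrtr_gt0 divr_gt0.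
exists (2^-1 ^+ N * (kappa * t)).
  by rewrite !mulr_gt0 // exprn_gt0.
move=> d x y h.
have fewn (n : nat) : n \in iota 0 N ->
    few (tau / N.+1%:R) (fun k => kappa < nrm (p n (x k) - p n (y k))).
  rewrite mem_iota /= add0n => nN.
  have n2 : norm2 (fun k => p n (x k) - p n (y k)) <= kappa * t.
    have pos m : (0 <= (2^-1 ^+ m.+1 *
        norm2 (fun k => p m (x k) - p m (y k)))%:E :> \bar R)%E.
      by rewrite lee_fin mulr_ge0 ?norm2_ge0 // exprn_ge0.
    have : ((2^-1 ^+ n.+1 * norm2 (fun k => p n (x k) - p n (y k)))%:E <=
             (2^-1 ^+ N * (kappa * t))%:E :> \bar R)%E.
      apply: le_trans h.
      apply: le_trans (nneseries_lim_ge n.+1 (fun m _ _ => pos m)).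
      by rewrite big_nat_recr //= leeDr // sume_ge0.
    rewrite lee_fin => /le_trans /(_ (ler_wpM2r _ (ler_wiXn2l _ _ nN))) h'.
    rewrite -(@ler_pM2l _ (2^-1 ^+ n.+1)) ?exprn_gt0 //; apply: h'.
    - by rewrite mulr_ge0 // ltW.
    - by [].
    - by rewrite invf_le1 ?ler1n.
  have -> : tau / N.+1%:R = (kappa * t / kappa) ^+ 2.
    by rewrite mulrAC mulfV ?gt_eqF // mul1r sqr_sqrtr // divr_ge0 // ltW.
  exact: norm2_few.
apply: few_sub (few_le _ (few_mem fewn)).
  by move=> k [n nN kn]; exists n => //; rewrite mem_iota.
rewrite size_iota -[_ *+ N]mulr_natr mulrAC ler_pdivrMr // ler_wpM2l ?(ltW t0) //.
by rewrite ler_nat.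
Qed.

(** Conversely, near agreement of finitely many members at most indices forces
    a small mean-square distance; the tail of the series is at most 2 / 2^N. *)
Lemma few_pdist p : (forall n x, nrm (p n x) <= 1) ->
  forall e : R, 0 < e ->
  exists N : nat, exists kappa tau : R, [/\ 0 < kappa, 0 < tau &
    forall d (x y : 'I_d -> X),
    few tau (fun k => apart p N kappa (x k) (y k)) -> (pdist p x y < e%:E)%E].
Proof.
move=> p1 e e0.
have [N Ne] : exists N : nat, 2 * 2^-1 ^+ N < e / 2.
  have : (2 : R) * 2^-1 ^+ n @[n --> \oo] --> 0.
    rewrite -[0](mulr0 2); apply: cvgMr; apply: cvg_expr.
    by rewrite ger0_norm // invf_lt1 ?ltr1n.
  move=> /cvgrPdist_lt /(_ (e / 2)) []; first by rewrite divr_gt0.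
  move=> N _ /(_ N (leqnn _)) /=; rewrite sub0r normrN ger0_norm ?mulr_ge0 ?exprn_ge0 //.
  by exists N.
exists N, (e / 4), ((e / 4) ^+ 2 / 4); split; rewrite ?divr_gt0 ?exprn_gt0 ?divr_gt0 //.
move=> d x y h.
pose f n := norm2 (fun k => p n (x k) - p n (y k)).
have fN n : (n < N)%N -> f n <= e / 2.
  move=> nN; apply: (@few_norm2 _ _ ((e / 4) ^+ 2 / 4) (e / 4)).
  - by rewrite divr_ge0 ?sqr_ge0.
  - by rewrite divr_ge0 ?ltW.
  - by rewrite divr_ge0 ?ltW.
  - by nra.
  - by move=> k; apply: le_trans (nrm_leB _ _) _; rewrite -[2]/(1 + 1) lerD.
  - by apply: few_sub h => k kn; exists n.
have f2 n : f n <= 2.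
  apply: (@few_norm2 _ _ 0 2) => //; first by rewrite mulr0 addr0.
    by move=> k; apply: le_trans (nrm_leB _ _) _; rewrite -[2]/(1 + 1) lerD.
  rewrite /few mul0r lern0; apply/eqP; apply: eq_card0 => k.
  rewrite !inE; apply/asboolP => /lt_geF.
  by rewrite (le_trans (nrm_leB _ _)) // -[2]/(1 + 1) lerD.
have w0 n : 0 <= 2^-1 ^+ n.+1 :> R by rewrite exprn_ge0.
have pos n c : 0 <= c -> (0 <= (2^-1 ^+ n.+1 * c)%:E :> \bar R)%E.
  by move=> c0; rewrite lee_fin mulr_ge0.
rewrite /pdist (nneseries_split_cond 0 N); last first.
  by move=> n _; apply: pos; exact: norm2_ge0.
rewrite add0n.
apply: (@le_lt_trans _ _ ((e / 2)%:E + (2 * 2^-1 ^+ N)%:E)%E); last first.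
  by rewrite -EFinD lte_fin; lra.
apply: leeD.
  apply: (@le_trans _ _ (\sum_(0 <= n <oo) (2^-1 ^+ n.+1 * (e / 2))%:E)%E).
    apply: le_trans (nneseries_lim_ge N _); last first.
      by move=> n _ _; apply: pos; rewrite divr_ge0 ?ltW.
    rewrite !big_nat; apply: lee_sum => n /andP[_ nN].
    by rewrite lee_fin ler_wpM2l // fN.
  have e20 : 0 <= e / 2 by lra.
  by rewrite (half_series 0 e20) expr0 mulr1.
rewrite -half_series //; apply: lee_nneseries => n _.
  by move=> _; apply: pos; exact: norm2_ge0.
by rewrite lee_fin ler_wpM2l // f2.
Qed.

End Distances.

(** * Upper limits and separated sets *)

Section Separation.
Context {R : realType}.

Lemma le_limn_esup (u v : (\bar R)^nat) :
  (\forall n \near \oo, (u n <= v n)%E) -> (limn_esup u <= limn_esup v)%E.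
Proof.
move=> uv; apply: le_ereal_inf_tmp => _ [V Voo <-]; apply: ge_ereal_inf.
exists (ereal_sup (u @` (V `&` [set n | (u n <= v n)%E]))).
  by exists (V `&` [set n | (u n <= v n)%E]) => //; exact: filterI.
apply: ge_ereal_sup => _ [n [Vn uvn] <-]; apply: le_trans uvn _.
by apply: ereal_sup_ubound; exists n.
Qed.

Lemma le_lne (x y : \bar R) : (x <= y)%E -> (lne x <= lne y)%E.
Proof.
move=> xy; have [x0|x0] := leP x 0%E; first by rewrite le0_lneNy // leNye.
by rewrite lee_lne // in_itv /= leey ltW // (lt_le_trans x0).
Qed.

Lemma limn_esup_le_near (u : nat -> \bar R) (l : \bar R) :
  (\forall n \near \oo, (u n <= l)%E) -> (limn_esup u <= l)%E.
Proof.
move=> /(@le_limn_esup u (fun=> l)) /le_trans; apply.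
by rewrite (cvg_limn_einf_sup (cvg_cst l)).2.
Qed.

Lemma le_Nsep (T : Type) (e e' : R) (Y Y' : set T) (rho rho' : T -> T -> \bar R) :
  Y `<=` Y' ->
  (forall x y, Y x -> Y y -> (e%:E < rho x y)%E -> (e'%:E < rho' x y)%E) ->
  (Nsep e Y rho <= Nsep e' Y' rho')%E.
Proof.
move=> YY h; apply: ereal_sup_le => _ [n [E [EY En Esep]] <-].
exists n => //; exists E; split=> //; first exact: subset_trans YY.
by move=> x y Ex Ey xy; apply: h; [exact: EY|exact: EY|exact: Esep].
Qed.

(** A separated set injects into W when f distinguishes separated points. *)
Lemma Nsep_le_card (U : Type) (W : finType) (P : pred W)
    (f : U -> W) (e : R) (Y : set U) (rho : U -> U -> \bar R) :
  (forall x, Y x -> P (f x)) ->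
  (forall x y, Y x -> Y y -> (e%:E < rho x y)%E -> f x <> f y) ->
  (Nsep e Y rho <= #|P|%:R%:E)%E.
Proof.
move=> YP finj; apply: ge_ereal_sup => _ [n [E [EY En Esep]] <-].
rewrite lee_fin ler_nat -card_le_II -(card_le_eql En).
pose h x := index (f x) (enum P).
have memP x : E x -> f x \in enum P.
  by move=> /EY /YP Px; rewrite mem_enum.
have hinj : {in E &, injective h}.
  move=> x y /set_mem Ex /set_mem Ey hxy; apply: contrapT => xy.
  apply: (finj x y (EY _ Ex) (EY _ Ey) (Esep x y Ex Ey xy)).
  have := congr1 (nth (f x) (enum P)) hxy.
  by rewrite !nth_index ?memP.
rewrite -(card_le_eql (inj_card_eq hinj)); apply: subset_card_le => _ [x Ex <-].
by rewrite /= /h cardE index_mem memP.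
Qed.

End Separation.

(** * Independence of the generating sequence *)

Section Control.
Context {R : realType} {G : groupType} {X : topologicalType}.
Variables (a : cts_action G X) (cX : compact [set: X]).
Notation nrm := Normc.normc.
Implicit Types p q : nat -> cfun X R.

Lemma nrm_le_sup_norm (f : cfun X R) x : nrm (f x) <= sup_norm f.
Proof.
pose g (x : X) : R := nrm (f x).
have cg : continuous g by move=> y; apply: cvg_nrm; exact: cfun_continuous.
have /compact_bounded[M [_ MP]] : compact (g @` [set: X]).
  by apply: continuous_compact => //; exact: continuous_subspaceT.
apply: sup_ubound; last by exists x.
exists (M + 1) => _ [y _ <-]; apply: le_trans (ler_norm _) _.
by apply: (MP (M + 1)); [rewrite ltrDl | exists y].
Qed.

(** Points that no p n separates along their orbits are not separated by any
    continuous function: the functions that do not separate them form an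
    invariant unital C*-subalgebra. *)
Lemma generating_separates p u v : dynamically_generating a p ->
  (forall s n, p n (a s u) = p n (a s v)) -> forall f : cfun X R, f u = f v.
Proof.
move=> gp puv f.
pose B : set (cfun X R) := [set f | forall s, f (a s u) = f (a s v)].
suff Bf : B f by have := Bf 1%g; rewrite !Defs.act1.
suff -> : B = [set: cfun X R] by [].
apply: gp => [|s g Bg t|g [n _ <-] s]; last exact: puv.
- split => // [c g h Bg Bh s|g h Bg Bh s|g Bg s|g Bg s].
  + by transitivity (c * g (a s u) + h (a s u)) => //; rewrite Bg Bh.
  + by transitivity (g (a s u) * h (a s u)) => //; rewrite Bg Bh.
  + by transitivity ((g (a s u))^*%C) => //; rewrite Bg.
  + apply/eqP; rewrite -subr_eq0 -nrm_eq0 eq_le nrm_ge0 andbT.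
    apply/ler_addgt0Pl => e e0; rewrite addr0.
    have [|h Bh gh] := Bg (e / 2); first by rewrite divr_gt0.
    have gx x : nrm (g x - h x) < e / 2.
      by apply: le_lt_trans gh; exact: (nrm_le_sup_norm (g - h)).
    apply: le_trans (nrm_le_distD _ (h (a s u)) _) _.
    rewrite {2}(Bh s) [X in _ + X]nrm_distC.
    by have := gx (a s u); have := gx (a s v); lra.
- transitivity (g (a (s^-1 * t)%g u)); first by rewrite Defs.actM.
  by rewrite Bg Defs.actM.
Qed.

Lemma apart_le p N N' kappa kappa' u v : (N <= N')%N -> kappa' <= kappa ->
  apart p N kappa u v -> apart p N' kappa' u v.
Proof.
move=> NN kk [n nN nk]; exists n; first exact: leq_trans NN.
exact: le_lt_trans nk.
Qed.

(** By compactness of the set of pairs that f separates by kappa. *)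
Lemma separating_control p (f : cfun X R) (kappa : R) :
  (forall u v, (forall s n, p n (a s u) = p n (a s v)) -> f u = f v) ->
  0 < kappa ->
  exists (E : seq G) (N' : nat) (kappa' : R), 0 < kappa' /\
    forall u v, kappa < nrm (f u - f v) ->
    exists2 s, s \in E & apart p N' kappa' (a s u) (a s v).
Proof.
move=> sep k0.
pose K := [set z : X * X | kappa <= nrm (f z.1 - f z.2)].
have Kc : compact K.
  apply: (@subclosed_compact _ K ([set: X] `*` [set: X])) => //.
    have -> : K = (fun z : X * X => nrm (f z.1 - f z.2) : R) @^-1` [set r | kappa <= r].
      by [].
    apply: closed_comp; last exact: closed_ge.
    by move=> z _; exact: cfun_dist_continuous.
  exact: compact_setX.
pose U (i : G * nat * nat) := [set z : X * X |
  i.2.+1%:R^-1 < nrm (p i.1.2 (a i.1.1 z.1) - p i.1.2 (a i.1.1 z.2))].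
have Uo i : open (U i).
  case: i => -[s n] m.
  have E x : alpha a s^-1%g (p n) x = p n (a s x).
    by transitivity (p n (a s^-1^-1%g x)); rewrite // invgK.
  have cU : continuous (fun z : X * X => nrm (p n (a s z.1) - p n (a s z.2)) : R).
    rewrite (_ : (fun z : X * X => _) = fun z : X * X =>
      nrm (alpha a s^-1%g (p n) z.1 - alpha a s^-1%g (p n) z.2) : R).
      exact: cfun_dist_continuous.
    by apply/funext => z; rewrite !E.
  have := @open_comp _ _ _ _ (fun z _ => cU z) (@open_gt R m.+1%:R^-1).
  exact.
have [|t tP] := compact_subcover Kc Uo.
  move=> [u v]; rewrite /K /= => kuv; apply: contrapT => nU.
  have fuv : f u = f v.
    apply: sep => s n; apply/eqP.
    rewrite -subr_eq0 -nrm_eq0 eq_le nrm_ge0 andbT leNgt; apply/negP => pos.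
    apply: nU; have [m _ mP] := near_infty_natSinv_lt (PosNum pos).
    by exists (s, n, m); exact: (mP m (leqnn m)).
  by move: kuv; rewrite fuv subrr nrm0 leNgt k0.
exists [seq i.1.1 | i <- t], (\max_(i <- t) i.1.2).+1,
  (\max_(i <- t) i.2).+1%:R^-1; split; first by rewrite invr_gt0.
move=> u v kuv; have [|[[s n] m] it Uuv] := tP (u, v); first exact: ltW.
exists s; first by apply/mapP; exists (s, n, m).
exists n; first by rewrite ltnS (@leq_bigmax_seq _ t xpredT (fun i => i.1.2) (s, n, m)).
apply: le_lt_trans Uuv; rewrite lef_pV2 ?posrE // ler_nat ltnS.
exact: (@leq_bigmax_seq _ t xpredT (fun i => i.2) (s, n, m)).
Qed.

(** Finitely many translates of finitely many members of a generating sequence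
    control any other finite family of continuous functions. *)
Lemma generating_control p q N (kappa : R) :
  dynamically_generating a p -> 0 < kappa ->
  exists (E : seq G) (N' : nat) (kappa' : R), 0 < kappa' /\
    forall u v, apart q N kappa u v ->
    exists2 s, s \in E & apart p N' kappa' (a s u) (a s v).
Proof.
move=> gp k0; elim: N => [|N [E [N1 [k1 [k10 IH]]]]].
  by exists [::], 0, 1; split=> // u v [].
have [E' [N2 [k2 [k20 P2]]]] := separating_control (fun u v puv =>
  generating_separates gp puv (q N)) k0.
exists (E ++ E'), (maxn N1 N2), (Num.min k1 k2); split.
  by rewrite lt_min k10.
move=> u v [n nN kn]; move: nN; rewrite ltnS leq_eqVlt => /predU1P[nE|nN].
  rewrite nE in kn; have [s sE As] := P2 _ _ kn.
  exists s; first by rewrite mem_cat sE orbT.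
  by apply: apart_le As; rewrite ?leq_maxr // ge_min lexx orbT.
have [|s sE As] := IH u v; first by exists n.
exists s; first by rewrite mem_cat sE.
by apply: apart_le As; rewrite ?leq_maxl // ge_min lexx.
Qed.

(** The d-tuple x follows the almost action sigma up to delta on F; these are
    the points of approx_hom when homomorphisms are read as evaluations. *)
Definition microstate p (F : set G) (delta : R) d (sigma : G -> 'S_d)
    (x : 'I_d -> X) : Prop :=
  forall s, F s -> (pdist p (fun k => a s^-1%g (x k))
    (fun k => x ((sigma s)^-1%g k)) < delta%:E)%E.

Lemma rho_seq_eval p d (phi psi : cfun X R -> 'I_d -> R[i]) x y :
  (forall f k, phi f k = f (x k)) -> (forall f k, psi f k = f (y k)) ->
  rho_seq p phi psi = pdist p x y.
Proof.
move=> phix psiy; apply: eq_eseriesr => n _; congr (_ * norm2 _)%:E.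
apply/funext => k.
by transitivity (phi (p n) k - psi (p n) k) => //; rewrite phix psiy.
Qed.

Lemma approx_hom_eval p F (delta : R) d (sigma : G -> 'S_d)
    (phi : cfun X R -> 'I_d -> R[i]) x :
  linear phi -> monoid_morphism phi -> (forall f k, phi f k = f (x k)) ->
  approx_hom a p F delta sigma phi <-> microstate p F delta sigma x.
Proof.
move=> lphi mphi phix.
have E s : (\sum_(0 <= n <oo) (2^-1 ^+ n.+1 *
    norm2 (phi (alpha a s (p n)) - perm_act (sigma s) (phi (p n))))%:E =
    pdist p (fun k => a s^-1%g (x k)) (fun k => x ((sigma s)^-1%g k)))%E.
  apply: eq_eseriesr => n _; congr (_ * norm2 _)%:E.
  apply/funext => k; transitivity
    (phi (alpha a s (p n)) k - phi (p n) ((sigma s)^-1%g k)) => //.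
  by rewrite !phix.
by split=> [[_ _ h] s /h|h]; rewrite ?E //; split=> // s /h; rewrite E.
Qed.

Lemma approx_hom_points p F (delta : R) d (sigma : G -> 'S_d)
    (phi : cfun X R -> 'I_d -> R[i]) :
  approx_hom a p F delta sigma phi ->
  exists2 x, (forall f k, phi f k = f (x k)) & microstate p F delta sigma x.
Proof.
move=> hphi; have [lphi mphi _] := hphi.
have [x xP] := unital_hom_eval cX lphi mphi.
by exists x => //; apply/(approx_hom_eval _ _ _ _ lphi mphi xP).
Qed.

Lemma microstate_few p F N (kappa tau : R) : 0 < kappa -> 0 < tau ->
  exists2 delta : R, 0 < delta & forall d (sigma : G -> 'S_d) x s,
    microstate p F delta sigma x -> F s ->
    few tau (fun k => apart p N kappa (a s^-1%g (x k)) (x ((sigma s)^-1%g k))).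
Proof.
move=> k0 t0; have [e e0 eP] := pdist_few p N k0 t0.
by exists e => // d sigma x s mx Fs; apply: eP; apply: ltW; exact: mx.
Qed.

Lemma microstate_le p (F F' : set G) (delta delta' : R) d (sigma : G -> 'S_d) x :
  F' `<=` F -> delta <= delta' ->
  microstate p F delta sigma x -> microstate p F' delta' sigma x.
Proof.
move=> FF dd mx s Fs; apply: lt_le_trans (mx s (FF _ Fs)) _.
by rewrite lee_fin.
Qed.

(** On the microstates of p, closeness in the pseudometric of p forces
    closeness in that of q. *)
Lemma pdist_control p q (e : R) :
  (forall n x, nrm (q n x) <= 1) -> dynamically_generating a p -> 0 < e ->
  exists (F : seq G) (delta e' : R), [/\ 0 < delta, 0 < e' &
    forall d (sigma : G -> 'S_d) x y,
    microstate p [set` F] delta sigma x -> microstate p [set` F] delta sigma y ->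
    (pdist p x y <= e'%:E)%E -> (pdist q x y < e%:E)%E].
Proof.
move=> q1 gp e0.
have [N [k [t [k0 t0 few_q]]]] := few_pdist q1 e0.
have [E [N' [k' [k'0 ctrl]]]] := generating_control q N gp k0.
pose t' := t / 3 / (size E).+1%:R.
have t'0 : 0 < t' by rewrite !divr_gt0.
have k30 : 0 < k' / 3 by rewrite divr_gt0.
(* For s in E, the tuples s x and s y are compared through
   x o sigma_(s^-1)^-1 and y o sigma_(s^-1)^-1, which costs three errors. *)
pose F := [seq s^-1%g | s <- E].
have [dl dl0 dlP] := microstate_few p [set` F] N' k30 t'0.
have [e' e'0 e'P] := pdist_few p N' k30 t'0.
exists F, dl, e'; split=> // d sigma x y mx my pxy.
apply: few_q.
have fewE s : s \in E ->
    few (t / (size E).+1%:R) (fun k => apart p N' k' (a s (x k)) (a s (y k))).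
  move=> sE; have Fs : [set` F] s^-1%g by rewrite /= map_f.
  have fx := dlP _ _ _ _ mx Fs; have fy := dlP _ _ _ _ my Fs.
  have fxy := few_perm (sigma s^-1%g)^-1%g (e'P _ _ _ pxy).
  rewrite invgK in fx fy.
  apply: few_sub (few_le _ (few_or fx (few_or fxy fy))); last first.
    by rewrite le_eqVlt; apply/orP; left; apply/eqP; rewrite /t'; field.
  move=> j; rewrite {1}(_ : k' = k' / 3 + (k' / 3 + k' / 3)); last by field.
  move=> /(apart_trans (x ((sigma s^-1%g)^-1%g j)))[|]; first by left.
  move=> /(apart_trans (y ((sigma s^-1%g)^-1%g j)))[|h]; right; first by left.
  by right; exact: apart_sym.
apply: few_sub (few_le _ (few_mem fewE)); first by move=> j /ctrl.
rewrite -[_ *+ _]mulr_natr mulrAC ler_pdivrMr // ler_wpM2l ?(ltW t0) //.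
by rewrite ler_nat.
Qed.

End Control.

Section SoficNear.
Context {R : realType} {G : groupType}.
Context {d : nat -> nat} (sigma : forall i, G -> 'S_(d i)).

Lemma few_near (P : forall i, pred 'I_(d i)) (tau : R) : 0 < tau ->
  #|[pred k | P i k]|%:R / (d i)%:R @[i --> \oo] --> (1 : R) ->
  \forall i \near \oo, few tau (fun k => ~~ P i k).
Proof.
move=> t0 /cvgrPdist_lt /(_ _ t0); apply: filterS => i.
have E : #|[pred k | `[< ~~ P i k >]]|%:R = (d i)%:R - #|[pred k | P i k]|%:R :> R.
  rewrite -[X in X%:R - _](card_ord (d i)) -(cardC [pred k | P i k]) natrD addrC addKr.
  by congr (_%:R); apply: eq_card => k; rewrite !inE; apply/asboolP/idP.
rewrite /few E => h.
have [d0|d0] := posnP (d i).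
  rewrite [X in X%:R - _]d0 [X in _ * X%:R]d0 mulr0 sub0r oppr_le0.
  exact: ler0n.
have dR : 0 < (d i)%:R :> R by rewrite ltr0n.
rewrite -ler_pdivrMr // mulrBl mulfV ?gt_eqF //.
by apply: ltW; apply: le_lt_trans h; exact: ler_norm.
Qed.

Lemma almost_multiplicative_near (s t : G) (tau : R) :
  almost_multiplicative R sigma -> 0 < tau ->
  \forall i \near \oo, few tau (fun k =>
    (sigma i (s * t)%g)^-1%g k <> (sigma i t)^-1%g ((sigma i s)^-1%g k)).
Proof.
move=> am t0.
have := few_near (P := fun i k => sigma i (s * t)%g k == sigma i s (sigma i t k))
  t0 (am s t).
apply: filterS => i /(few_perm (sigma i (s * t)%g)^-1%g).
apply: few_sub => k; rewrite permKV => h; apply/negP => /eqP kE; apply: h.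
by rewrite {2}kE !permK.
Qed.

Lemma almost_free_near (s t : G) (tau : R) :
  almost_free R sigma -> s <> t -> 0 < tau ->
  \forall i \near \oo, few tau (fun k =>
    (sigma i s)^-1%g k = (sigma i t)^-1%g k).
Proof.
move=> af st t0.
have := few_near (P := fun i k => sigma i s k != sigma i t k) t0 (af _ _ st).
apply: filterS => i /(few_perm (sigma i s)^-1%g).
by apply: few_sub => k kE; rewrite negbK permKV kE permKV.
Qed.

Lemma near_mem (I : eqType) (s : seq I) (P : I -> nat -> Prop) :
  (forall j, j \in s -> \forall i \near \oo, P j i) ->
  \forall i \near \oo, forall j, j \in s -> P j i.
Proof.
elim: s => [_|j s IH h]; first by apply: nearW.
have h1 : \forall i \near \oo, P j i by apply: h; exact: mem_head.
have h2 : \forall i \near \oo, forall j, j \in s -> P j i.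
  by apply: IH => l ls; apply: h; rewrite inE ls orbT.
by apply: filterS2 h1 h2 => i Pj Ps l; rewrite inE => /predU1P[->|/Ps].
Qed.

End SoficNear.

Section Independence.
Context {R : realType} {G : groupType} {X : topologicalType}.
Variables (a : cts_action G X) (cX : compact [set: X]).
Context {d : nat -> nat} (sigma : forall i, G -> 'S_(d i)).
Hypothesis sofic_sigma : sofic_approximation R sigma.
Notation nrm := Normc.normc.
Implicit Types p q : nat -> cfun X R.

(** Good enough microstates of p are microstates of q. *)
Lemma microstate_transfer p q (F : seq G) (delta : R) :
  (forall n x, nrm (q n x) <= 1) -> dynamically_generating a p -> 0 < delta ->
  exists (F1 : seq G) (delta1 : R), 0 < delta1 /\
    \forall i \near \oo, forall x,
    microstate a p [set` F1] delta1 (sigma i) x ->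
    microstate a q [set` F] delta (sigma i) x.
Proof.
move=> q1 gp d0; have [_ am _] := sofic_sigma.
have [N [k [t [k0 t0 few_q]]]] := few_pdist q1 d0.
have [E [N' [k' [k'0 ctrl]]]] := generating_control cX q N gp k0.
pose t' := t / 3 / (size E).+1%:R.
have t'0 : 0 < t' by rewrite !divr_gt0.
have k20 : 0 < k' / 2 by rewrite divr_gt0.
(* For r in E, r (s^-1 x) = (s r^-1)^-1 x is compared with r (x o sigma_s^-1)
   through x o sigma_(s r^-1)^-1, which mostly agrees with
   x o sigma_(r^-1)^-1 o sigma_s^-1 because sigma is almost multiplicative. *)
pose F1 := [seq (s * t^-1)%g | s <- F, t <- E] ++ [seq t^-1%g | t <- E].
have [dl dl0 dlP] := microstate_few a p [set` F1] N' k20 t'0.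
exists F1, dl; split=> //.
have := @near_mem _ (allpairs pair F E) (fun st i => few t' (fun k =>
  (sigma i (st.1 * st.2^-1)%g)^-1%g k <>
  (sigma i st.2^-1%g)^-1%g ((sigma i st.1)^-1%g k)))
  (fun st _ => almost_multiplicative_near st.1 st.2^-1%g am t'0).
apply: filterS => i mult x mx s /= Fs; apply: few_q.
have fewE r : r \in E -> few (t / (size E).+1%:R) (fun k =>
    apart p N' k' (a r (a s^-1%g (x k))) (a r (x ((sigma i s)^-1%g k)))).
  move=> rE.
  have F1sr : [set` F1] (s * r^-1)%g.
    by rewrite /= mem_cat; apply/orP; left; apply: allpairs_f.
  have F1r : [set` F1] r^-1%g by rewrite /= mem_cat map_f ?orbT.
  have f1 := dlP _ _ _ _ mx F1sr.
  have f2 := few_perm (sigma i s)^-1%g (dlP _ _ _ _ mx F1r).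
  have f3 := mult (s, r) (allpairs_f pair Fs rE).
  rewrite /= in f2 f3.
  apply: few_sub (few_le _ (few_or f1 (few_or f3 f2))); last first.
    by rewrite le_eqVlt; apply/orP; left; apply/eqP; rewrite /t'; field.
  move=> j; rewrite invMg !invgK Defs.actM {1}(_ : k' = k' / 2 + k' / 2); last by field.
  move=> /(apart_trans (x ((sigma i (s * r^-1)%g)^-1%g j)))[|h]; first by left.
  right; have [eqj|neqj] := pselect ((sigma i (s * r^-1)%g)^-1%g j =
    (sigma i r^-1%g)^-1%g ((sigma i s)^-1%g j)); last by left.
  by right; apply: apart_sym; rewrite -eqj.
apply: few_sub (few_le _ (few_mem fewE)); first by move=> j /ctrl.
rewrite -[_ *+ _]mulr_natr mulrAC ler_pdivrMr // ler_wpM2l ?(ltW t0) //.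
by rewrite ler_nat.
Qed.

Lemma real_unit_ball_nrm p : real_unit_ball p -> forall n x, nrm (p n x) <= 1.
Proof.
by move=> hp n x; apply: le_trans (nrm_le_sup_norm cX _ _) (hp n).2.
Qed.

Lemma entropy_seq_le p q : generator a p -> generator a q ->
  (entropy_seq a sigma q <= entropy_seq a sigma p)%E.
Proof.
move=> [p1 gp] [q1 gq].
have {}p1 := real_unit_ball_nrm p1; have {}q1 := real_unit_ball_nrm q1.
apply: ge_ereal_sup => _ [e /= e0 <-].
have [F2 [dl2 [e' [dl20 e'0 ctrl]]]] := pdist_control cX q1 gp e0.
apply: le_ereal_sup_tmp; eexists; first by exists e'.
apply: le_ereal_inf_tmp => _ [F [/finite_seqP[Fs FE] F0] <-].
apply: le_ereal_inf_tmp => _ [dl /= dl0 <-].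
have m0 : 0 < Num.min dl dl2 by rewrite lt_min dl0.
have [F1 [dl1 [dl10 trans]]] := microstate_transfer (Fs ++ F2) p1 gq m0.
(* The identity only makes the finite set nonempty. *)
apply: ge_ereal_inf; eexists.
  exists [set` (1%g :: F1)] => //.
  by split; [exact: finite_seq|exists 1%g; exact: mem_head].
apply: ge_ereal_inf; eexists; first by exists dl1.
apply: le_limn_esup; apply: filterS trans => i trans.
apply: lee_wpmul2l; first by rewrite lee_fin invr_ge0.
apply: le_lne.
have sub phi : approx_hom a q [set` (1%g :: F1)] dl1 (sigma i) phi ->
    exists x, [/\ forall f k, phi f k = f (x k),
      microstate a p F dl (sigma i) x & microstate a p [set` F2] dl2 (sigma i) x].
  move=> /(approx_hom_points cX)[x phix mx]; exists x.
  have /trans mx' : microstate a q [set` F1] dl1 (sigma i) x.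
    by apply: microstate_le mx => // s /= sF; rewrite inE sF orbT.
  split=> //; apply: microstate_le mx'; rewrite ?ge_min ?lexx ?orbT //.
    by rewrite FE => s /= sF; rewrite mem_cat sF.
  by move=> s /= sF; rewrite mem_cat sF orbT.
apply: le_Nsep => [phi hphi|phi psi /sub[x [phix _ mx]] /sub[y [psiy _ my]]].
  have [lphi mphi _] := hphi; have [x [phix mx _]] := sub _ hphi.
  by apply/(approx_hom_eval a _ _ _ _ lphi mphi phix).
rewrite (rho_seq_eval q phix psiy) (rho_seq_eval p phix psiy) !ltNge.
by apply: contra => /(ctrl _ _ _ _ mx my)/ltW.
Qed.

(** The entropy does not depend on the generating sequence. *)
Lemma topological_entropyE p : generator a p ->
  topological_entropy (R := R) a sigma = entropy_seq a sigma p.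
Proof.
move=> gp; have : common_entropy a sigma (entropy_seq a sigma p).
  split; first by exists p.
  move=> q gq; apply/le_anti/andP.
  by split; [exact: (entropy_seq_le gp gq)|exact: (entropy_seq_le gq gp)].
move=> hp; apply: (xget_unique _ hp) => h [_ hall].
by apply/esym; exact: hall.
Qed.

End Independence.

(** * Words avoiding a pattern *)

(** A graph with degrees at most M has an independent set containing at least
    one vertex out of M + 1: a maximal one. *)
Lemma greedy_independent (T : finType) (e : rel T) (D : {set T}) (M : nat) :
  symmetric e -> (forall v, #|[pred k | e v k]| <= M)%N ->
  exists V : {set T}, [/\ V \subset D,
    {in V &, forall k l, k != l -> ~~ e k l} & (#|D| <= #|V| * M.+1)%N].
Proof.
move=> esym eM.
pose P (V : {set T}) := (V \subset D) &&
  [forall k in V, forall l in V, (k != l) ==> ~~ e k l].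
have P0 : P finset.set0.
  by rewrite /P finset.sub0set; apply/forall_inP => k; rewrite inE.
have [V /maxsetP[PV Vmax] _] := maxset_exists P0.
have /andP[VD /forall_inP Vind] := PV.
exists V; split=> // [k l kV lV kl|].
  by move/forall_inP: (Vind k kV) => /(_ l lV)/implyP; exact.
have Dcov k : k \in D -> exists2 v, v \in V & (k == v) || e v k.
  move=> kD; apply: contrapT => nk.
  have kV v : v \in V -> k != v /\ ~~ e v k.
    by move=> vV; apply/andP; rewrite -negb_or; apply/negP => h; apply: nk; exists v.
  have PkV : P (k |: V)%SET.
    rewrite /P finset.subUset finset.sub1set kD VD /=; apply/forall_inP => u.
    rewrite finset.in_setU1 => /predU1P[->|uV]; apply/forall_inP => v;
      rewrite finset.in_setU1 => /predU1P[->|vV]; apply/implyP => uv.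
    - by rewrite eqxx in uv.
    - by rewrite esym; exact: (kV v vV).2.
    - exact: (kV u uV).2.
    - by move/forall_inP: (Vind u uV) => /(_ v vV)/implyP; exact.
  have kinV : k \in V by rewrite -(Vmax _ PkV (finset.subsetUr _ _)) finset.setU11.
  by have [] := kV k kinV; rewrite eqxx.
apply: (@leq_trans (\sum_(v in V) \sum_(k in D) ((k == v) || e v k))%N).
  rewrite -sum1_card exchange_big /=; apply: leq_sum => k /Dcov[v vV kv].
  by rewrite (bigD1 v) //= kv.
rewrite -sum_nat_const; apply: leq_sum => v _.
apply: (@leq_trans (\sum_(k : T) ((k == v) + e v k))%N).
  rewrite big_mkcond /=; apply: leq_sum => k _.
  by case: (_ \in _) => //; case: (k == v).
rewrite big_split /= -!big_mkcond /= !sum1_card card1 add1n ltnS.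
exact: eM.
Qed.

Section Words.
Context {R : realType} (T A : finType) (m : nat).
(* The block of k is the m-tuple b k of positions. *)
Variables (b : T -> 'I_m -> T) (u : 'I_m -> A).
Implicit Types w : {ffun T -> A}.

(** The word w reads the pattern u along the block of k. *)
Definition occurs w k : bool := [forall i, w (b k i) == u i].

(** If h ignores the letters of the block of k, overwriting that block by u does
    not change h, and each result arises from at most #|A| ^ m words. *)
Lemma sum_occurs k (h : {ffun T -> A} -> R) : injective (b k) ->
  (forall w, 0 <= h w) ->
  (forall w w', (forall t, t \notin codom (b k) -> w t = w' t) -> h w = h w') ->
  \sum_w h w <= #|A|%:R ^+ m * \sum_(w | occurs w k) h w.
Proof.
move=> binj h0 hb.
(* r w is the word w with u written over the block of k. *)
pose r w : {ffun T -> A} :=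
  [ffun t => if [pick i | b k i == t] is Some i then u i else w t].
have rout w t : t \notin codom (b k) -> r w t = w t.
  move=> tb; rewrite ffunE; case: pickP => // i /eqP it.
  by rewrite -it codom_f in tb.
have rin w i : r w (b k i) = u i.
  rewrite ffunE; case: pickP => [j /eqP/binj -> //|/(_ i)].
  by rewrite eqxx.
have rocc w : occurs (r w) k by apply/forallP => i; rewrite rin.
rewrite mulr_sumr (partition_big r (occurs^~ k)) //=; apply: ler_sum => w' _.
apply: (@le_trans _ _ (\sum_(w | r w == w') h w')).
  apply: ler_sum => w /eqP <-; rewrite (hb w (r w)) // => t tb.
  by rewrite rout.
rewrite sumr_const -[leLHS]mulr_natl ler_wpM2r // -natrX ler_nat.
pose rest w := [ffun i => w (b k i)].
rewrite -[X in (_ <= _ ^ X)%N](card_ord m) -card_ffun.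
apply: (@leq_card_in _ _ rest).
move=> w v wF vF /ffunP wv; apply/ffunP => t.
have rw : r w = w' by exact/eqP.
have rv : r v = w' by exact/eqP.
have [/codomP[i ->]|tb] := boolP (t \in codom (b k)).
  by have := wv i; rewrite !ffunE.
by rewrite -(rout w) // -(rout v) // rw rv.
Qed.

(** Each of the disjoint blocks contributes at most a factor
    1 - (1 - z) / #|A|^m, the mean weight of an event of probability #|A|^-m. *)
Lemma sum_weight_occurs (z : R) (V : seq T) : 0 <= z <= 1 -> uniq V ->
  {in V, forall k, injective (b k)} ->
  {in V &, forall k l, k != l -> forall i j, b k i != b l j} ->
  \sum_w \prod_(k <- V) (if occurs w k then z else 1) <=
    #|A|%:R ^+ #|T| * (1 - (1 - z) / #|A|%:R ^+ m) ^+ size V.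
Proof.
move=> /andP[z0 z1]; elim: V => [_ _ _|k V IH /= /andP[kV uV] binj bdis].
  rewrite (eq_bigr (fun=> 1)) => [|w _]; last by rewrite big_nil.
  by rewrite sumr_const card_ffun expr0 mulr1 natrX.
pose h w := \prod_(l <- V) (if occurs w l then z else 1) : R.
have h0 w : 0 <= h w by apply: prodr_ge0 => l _; case: ifP.
have kin : k \in k :: V by exact: mem_head.
have lin l : l \in V -> l \in k :: V by move=> lV; rewrite inE lV orbT.
have hb w w' : (forall t, t \notin codom (b k) -> w t = w' t) -> h w = h w'.
  move=> ww; rewrite /h !big_seq; apply: eq_bigr => l lV.
  congr (if _ then _ else _); apply: eq_forallb => i; congr (_ == _).
  apply: ww; apply/negP => /codomP[j] /eqP; apply/negP.
  have kl : k != l by apply: contraNneq kV => ->.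
  by rewrite eq_sym; exact: (bdis k l kin (lin l lV) kl j i).
have key := sum_occurs (binj k kin) h0 hb.
have IH' : \sum_w h w <= #|A|%:R ^+ #|T| * (1 - (1 - z) / #|A|%:R ^+ m) ^+ size V.
  apply: IH => // [l lV|l l' lV lV']; first by apply: binj; exact: lin.
  by apply: bdis; exact: lin.
(* Only the empty alphabet makes the power vanish; then 1 / 0 = 0. *)
have [/eqP A0|A0] := boolP (#|A|%:R ^+ m == 0 :> R).
  rewrite A0 invr0 mulr0 subr0 !expr1n !mulr1 in IH' *.
  apply: le_trans IH'; apply: ler_sum => w _; rewrite big_cons.
  rewrite -[leRHS]mul1r; apply: ler_wpM2r; first exact: h0.
  by case: ifP.
have Apos : 0 < #|A|%:R ^+ m :> R by rewrite lt_neqAle eq_sym A0 exprn_ge0.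
have split1 : \sum_w h w = \sum_(w | occurs w k) h w + \sum_(w | ~~ occurs w k) h w.
  by rewrite (bigID (occurs^~ k)).
have -> : \sum_w \prod_(l <- k :: V) (if occurs w l then z else 1) =
    \sum_w h w - (1 - z) * \sum_(w | occurs w k) h w.
  rewrite split1 (bigID (occurs^~ k)) /=.
  rewrite (eq_bigr (fun w => z * h w)); last first.
    by move=> w wk; rewrite big_cons wk.
  rewrite [X in _ + X](eq_bigr h); last first.
    by move=> w /negbTE wk; rewrite big_cons wk mul1r.
  by rewrite -mulr_sumr; ring.
have q1 : 0 <= 1 - (1 - z) / #|A|%:R ^+ m.
  rewrite subr_ge0 ler_pdivrMr // mul1r; apply: (@le_trans _ _ 1); first by lra.
  rewrite -natrX ler1n expn_gt0; move: A0; rewrite -natrX pnatr_eq0 expn_eq0.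
  by case: m => [|m']; rewrite ?orbT // andbT -lt0n orbF.
apply: (@le_trans _ _ ((1 - (1 - z) / #|A|%:R ^+ m) * \sum_w h w)).
  rewrite [leRHS]mulrBl mul1r lerD2l lerN2 -mulrA ler_wpM2l ?subr_ge0 //.
  by rewrite mulrC ler_pdivrMr // mulrC.
by rewrite exprS mulrCA ler_wpM2l.
Qed.

(** The number of words in which u occurs along at most a fraction tau of the
    blocks, by Markov's inequality for the weight exp(-number of occurrences). *)
Lemma card_few_occurs (tau c : R) (V : {set T}) :
  (0 < #|A|)%N -> c * #|T|%:R <= #|V|%:R ->
  {in V, forall k, injective (b k)} ->
  {in V &, forall k l, k != l -> forall i j, b k i != b l j} ->
  #|[pred w : {ffun T -> A} | #|[pred k | occurs w k]|%:R <= tau * #|T|%:R]|%:R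
  <= expR (#|T|%:R *
       (ln #|A|%:R + tau + c * ln (1 - (1 - expR (-1)) / #|A|%:R ^+ m))).
Proof.
move=> A0 cV binj bdis.
set q := 1 - (1 - expR (-1)) / #|A|%:R ^+ m.
have z0 : 0 < expR (-1) :> R by exact: expR_gt0.
have z1 : expR (-1) < 1 :> R by rewrite expR_lt1 ltrN10.
have Apos : 0 < #|A|%:R ^+ m :> R by rewrite exprn_gt0 // ltr0n.
have A1 : 1 <= #|A|%:R ^+ m :> R by rewrite -natrX ler1n expn_gt0 A0.
have q0 : 0 < q.
  by rewrite subr_gt0 ltr_pdivrMr // mul1r; lra.
have q1 : q <= 1.
  by rewrite gerBl divr_ge0 // ?(ltW Apos) // subr_ge0 ltW.
have := @sum_weight_occurs (expR (-1)) (enum V) _ (enum_uniq V) _ _.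
rewrite -cardE => H.
have {}H : \sum_(w : {ffun T -> A}) \prod_(k in V) (if occurs w k then expR (-1) else 1)
    <= #|A|%:R ^+ #|T| * q ^+ #|V|.
  under eq_bigr do rewrite -big_enum.
  apply: H => [|k|k l]; rewrite ?mem_enum; last exact: bdis.
    by rewrite !ltW.
  exact: binj.
set W := [pred w : {ffun T -> A} | _].
have low : #|W|%:R * expR (- (tau * #|T|%:R)) <=
    \sum_(w : {ffun T -> A}) \prod_(k in V) (if occurs w k then expR (-1) else 1).
  rewrite -sum1_card natr_sum mulr_suml [leRHS](bigID W) /= -[leLHS]addr0.
  apply: lerD; last first.
    by apply: sumr_ge0 => w _; apply: prodr_ge0 => k _; case: ifP.
  apply: ler_sum => w; rewrite unfold_in /= => wW.
  rewrite mul1r -big_mkcondr /= prodr_const -expRM_natl ler_expR.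
  rewrite mulrN1 lerN2; apply: le_trans wW; rewrite ler_nat.
  by apply: subset_leq_card; apply/fintype.subsetP => k; rewrite !inE => /andP[].
have {}H := le_trans low H.
rewrite -(@ler_pM2r _ (expR (- (tau * #|T|%:R)))) ?expR_gt0 //; apply: (le_trans H).
rewrite -{1}(@lnK _ #|A|%:R) ?posrE ?ltr0n // -expRM_natl -{1}(@lnK _ q) //.
rewrite -expRM_natl -!expRD ler_expR.
have lq : ln q <= 0 by rewrite ln_le0.
have : #|V|%:R * ln q <= c * #|T|%:R * ln q by rewrite ler_wnM2r.
by lra.
Qed.

End Words.

(** * Subshifts *)

Lemma compact_set_type (T : topologicalType) (X : set T) :
  compact X -> compact [set: set_type X].
Proof.
move=> cX F FF _.
have [|x [Xx xF]] := cX (set_val @ F) _.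
  suff : F (set_val @^-1` X) by [].
  by apply: filterE => z; exact: set_valP.
exists (SigSub (mem_set Xx)); split=> // A B FA.
rewrite nbhsE => -[C [[D oD <-] Dx] CB].
have nD : nbhs x D by apply: open_nbhs_nbhs.
have FA' : (set_val @ F) (set_val @` A).
  suff : F (set_val @^-1` (set_val @` A)) by [].
  by apply: filterS FA => y Ay; exists y.
have [z [[y Ay <-] Dy]] := xF _ _ FA' nD.
by exists y; split=> //; exact: CB.
Qed.

Section Symbols.
Context {R : realType} {G : groupType} {A : finType}.
Variables (X : set (full_shift G A)) (invX : shift_invariant X).
Hypothesis closedX : closed X.
Notation XT := (set_type X).
Notation T := (subshift invX).
Notation nrm := Normc.normc.

Lemma compact_subshift : compact [set: XT].
Proof.
apply: compact_set_type; apply: (@subclosed_compact _ X setT) => //.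
have := @tychonoff G (fun=> discrete_topology A) (fun=> setT)
  (fun=> @finite_compact (discrete_topology A) setT (@finite_finset A setT)).
by congr (compact _); apply/seteqP.
Qed.

Lemma coord_open (s : G) (B : set A) : open [set x : XT | B (val x s)].
Proof.
have cs : continuous (fun x : XT => val x s : discrete_topology A).
  move=> x; apply: (@continuous_comp _ _ _ set_val
      (fun x : full_shift G A => x s : discrete_topology A)).
    exact: initial_continuous.
  exact: (@proj_continuous G (fun=> discrete_topology A) s).
have := @open_comp _ _ _ _ (fun x _ => cs x)
  (discrete_open (B : set (discrete_topology A))).
exact.
Qed.

Lemma symbol_subproof (c : A) :
  continuous (fun x : XT => ((val x 1%g == c)%:R : R[i])).
Proof.
move=> x; apply: near_cst_continuous.
have : open_nbhs x [set y : XT | val y 1%g = val x 1%g].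
  by split=> //; exact: (@coord_open 1%g [set b | b = val x 1%g]).
by move=> /open_nbhs_nbhs; apply: filterS => y /= ->.
Qed.

(** The indicator function of the points carrying the symbol c at 1. *)
Definition symbol (c : A) : cfun XT R := cfun_mk (@symbol_subproof c).

Lemma symbolE c (x : XT) : symbol c x = (val x 1%g == c)%:R.
Proof. by []. Qed.

(** The time-zero partition, as a sequence that vanishes after #|A| terms. *)
Definition symbols (n : nat) : cfun XT R := nth 0 [seq symbol c | c <- enum A] n.

Lemma symbols_cases n : symbols n = 0 \/ exists c, symbols n = symbol c.
Proof.
rewrite /symbols; have [nA|An] := ltnP n (size [seq symbol c | c <- enum A]).
  by right; have /mapP[c _ ->] := mem_nth 0 nA; exists c.
by left; rewrite nth_default.
Qed.

Lemma symbols_local n (u v : XT) :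
  val u 1%g = val v 1%g -> symbols n u = symbols n v.
Proof.
move=> uv; have [->|[c ->]] := symbols_cases n; first by [].
by rewrite !symbolE uv.
Qed.

Lemma symbols_apart (kappa : R) (u v : XT) : kappa < 1 ->
  val u 1%g <> val v 1%g -> apart symbols #|A| kappa u v.
Proof.
move=> k1 uv; exists (index (val u 1%g) (enum A)).
  by rewrite cardE index_mem mem_enum.
have -> : symbols (index (val u 1%g) (enum A)) = symbol (val u 1%g).
  rewrite /symbols (nth_map (val u 1%g)) ?index_mem ?mem_enum //.
  by rewrite nth_index ?mem_enum.
have -> : symbol (val u 1%g) u = 1 by rewrite symbolE eqxx.
have -> : symbol (val u 1%g) v = 0.
  by rewrite symbolE; case: eqP => // /esym.
by rewrite subr0 nrm1.
Qed.

Lemma subshift_coord (s t : G) (x : XT) : val (T s x) t = val x (s^-1 * t)%g.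
Proof. by []. Qed.

Lemma sup_norm_le (f : cfun XT R) (M : R) :
  0 <= M -> (forall x, nrm (f x) <= M) -> sup_norm f <= M.
Proof.
move=> M0 fM; rewrite /sup_norm.
have [->|/set0P ne] := eqVneq [set nrm (f x) | x in [set: XT]] set0.
  by rewrite sup0.
by apply: ge_sup => // _ [x _ <-].
Qed.

Lemma symbols_unit_ball : real_unit_ball symbols.
Proof.
move=> n; have [->|[c ->]] := symbols_cases n; split=> [x|].
- exact: real0.
- by apply: sup_norm_le => // x; rewrite nrm0.
- exact: realn.
- apply: sup_norm_le => // x; rewrite symbolE.
  by case: (_ == _); rewrite ?nrm0 ?nrm1.
Qed.

Lemma symbols_separate (u v : XT) :
  (forall s n, symbols n (T s u) = symbols n (T s v)) -> u = v.
Proof.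
move=> uv; apply/val_inj/funext => s; apply: contrapT => us.
have : apart symbols #|A| 0 (T s^-1%g u) (T s^-1%g v).
  by apply: symbols_apart => //; rewrite !subshift_coord invgK mulg1.
by move=> [n _]; rewrite uv subrr nrm0 ltxx.
Qed.

Lemma cfun_prodE (I : Type) (r : seq I) (F : I -> cfun XT R) x :
  (\prod_(i <- r) F i) x = \prod_(i <- r) F i x.
Proof. by elim/big_rec2: _ => // i y z _ <-. Qed.

(** A continuous function is uniformly close to one that depends on finitely
    many coordinates, hence to a polynomial in translates of the symbols. *)
Lemma symbols_generating : dynamically_generating T symbols.
Proof.
move=> B [B1 Blin BM _ Bcl] Binv Bsym; apply/seteqP; split=> // f _.
have B0 : B 0 by rewrite -[0](addNr (1 : cfun XT R)) -scaleN1r; exact: Blin.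
have BD g h : B g -> B h -> B (g + h).
  by move=> Bg Bh; rewrite -[g]scale1r; exact: Blin.
have BZ c g : B g -> B (c *: g) by move=> Bg; rewrite -[_ *: _]addr0; exact: Blin.
have Bs s c : B (alpha T s (symbol c)).
  apply: Binv; apply: Bsym; exists (index c (enum A)) => //.
  rewrite /symbols (nth_map c) ?index_mem ?mem_enum //.
  by rewrite nth_index ?mem_enum.
apply: Bcl => e e0.
have e20 : 0 < e / 2 by rewrite divr_gt0.
have [E [N [k [k0 Eapart]]]] := separating_control (a := T) (p := symbols)
  compact_subshift (f := f) (fun u v h => congr1 f (symbols_separate h)) e20.
(* w x is the restriction of x to the finite window of inverses of E, and c
   picks a value of f on each cylinder over that window. *)
pose w (x : XT) : {ffun 'I_(size E) -> A} :=
  [ffun i : 'I_(size E) => val x (nth 1%g E i)^-1%g].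
have wf u v : w u = w v -> nrm (f u - f v) <= e / 2.
  move=> /ffunP wuv; rewrite leNgt; apply/negP => /Eapart[s sE [n _]].
  rewrite (@symbols_local n (T s u) (T s v)) ?subrr ?nrm0.
    by rewrite ltNge ltW.
  rewrite !subshift_coord !mulg1.
  have sE' : (index s E < size E)%N by rewrite index_mem.
  by have := wuv (Ordinal sE'); rewrite !ffunE /= nth_index.
have [c cP] : {c : {ffun 'I_(size E) -> A} -> R[i] &
    forall v x, w x = v -> nrm (f x - c v) <= e / 2}.
  apply: (@boolp.choice _ _ (fun v c => forall x, w x = v -> nrm (f x - c) <= e / 2)).
  move=> v; have [[y <-]|nv] := pselect (exists y, w y = v).
    by exists (f y) => x; exact: wf.
  by exists 0 => x xv; exfalso; apply: nv; exists x.
pose g := \sum_(v : {ffun 'I_(size E) -> A})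
  c v *: \prod_(i < size E) alpha T (nth 1%g E i)^-1%g (symbol (v i)).
have gE x : g x = c (w x).
  rewrite /g cfun_sumE.
  have term v : (c v *: \prod_(i < size E) alpha T (nth 1%g E i)^-1%g (symbol (v i))) x =
      c v * (w x == v)%:R.
    transitivity (c v *
      (\prod_(i < size E) alpha T (nth 1%g E i)^-1%g (symbol (v i))) x) => //.
    rewrite cfun_prodE; congr (_ * _).
    have coef (i : 'I_(size E)) :
        alpha T (nth 1%g E i)^-1%g (symbol (v i)) x = (w x i == v i)%:R.
      transitivity ((val (T (nth 1%g E i)^-1^-1%g x) 1%g == v i)%:R : R[i]) => //.
      by rewrite subshift_coord invgK mulg1 ffunE.
    rewrite (eq_bigr _ (fun i _ => coef i)).
    have [<-|wv] := eqVneq (w x) v.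
      by rewrite big1 // => i _; rewrite eqxx.
    have [i wvi] : exists i, w x i != v i.
      apply: contrapT => h; move/eqP: wv; apply; apply/ffunP => i.
      by apply/eqP; apply: contrapT => /negP wvi; apply: h; exists i.
    by rewrite (bigD1 i) //= (negbTE wvi) mul0r.
  rewrite (eq_bigr _ (fun v _ => term v)) (bigD1 (w x)) //= eqxx mulr1.
  rewrite big1 ?addr0 // => v; rewrite eq_sym => /negbTE ->.
  by rewrite mulr0.
exists g.
  rewrite /g; elim/big_rec: _ => // v h _ Bh; apply: (BD _ _ _ Bh); apply: BZ.
  by elim/big_rec: _ => // i h' _ Bh'; exact: BM.
apply: (@le_lt_trans _ _ (e / 2)); last by lra.
apply: sup_norm_le; first exact: ltW.
move=> x; suff : nrm (f x - g x) <= e / 2 by [].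
by rewrite gE; exact: cP.
Qed.

Lemma symbols_generator : generator T symbols.
Proof. by split; [exact: symbols_unit_ball|exact: symbols_generating]. Qed.

(** A point outside a subshift violates it on a finite window. *)
Lemma forbidden_pattern (y : full_shift G A) : ~ X y ->
  exists S : seq G, forall x : XT, exists2 s, s \in S & val x s <> y s.
Proof.
move=> Xy.
have [|x _|S SP] := @compact_subcover _ _ _ (fun s => [set x : XT | val x s <> y s])
  compact_subshift.
- by move=> s; exact: (@coord_open s [set b | b <> y s]).
- apply: contrapT => nx; apply: Xy.
  have -> : y = val x; last exact: set_valP.
  by apply/funext => s; apply: contrapT => ys; apply: nx; exists s => /esym.
- by exists S => x; have [s] := SP x I; exists s.
Qed.

End Symbols.

(** * The entropy bound *)

Section Bound.
Context {R : realType} {G : groupType} {A : finType}.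
Variables (X : set (full_shift G A)) (invX : shift_invariant X).
Hypothesis closedX : closed X.
Context {d : nat -> nat} (sigma : forall i, G -> 'S_(d i)).
Hypothesis sofic_sigma : sofic_approximation R sigma.
Hypothesis A_gt0 : (0 < #|A|)%N.
Notation T := (subshift invX).
Notation XT := (set_type X).

(** The position read at k by the j-th element of the window S. *)
Definition window (S : seq G) i (k : 'I_(d i)) (j : 'I_(size S)) : 'I_(d i) :=
  (sigma i (nth 1%g S j))^-1%g k.
Arguments window S i k j : clear implicits.

(** Eventually there are at least c d_i disjoint injective windows. *)
Lemma disjoint_windows (S : seq G) : uniq S ->
  exists2 c : R, 0 < c & \forall i \near \oo, exists V : {set 'I_(d i)},
    [/\ c * (d i)%:R <= #|V|%:R,
      {in V, forall k, injective (window S i k)} &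
      {in V &, forall k l, k != l -> forall j j', window S i k j != window S i l j'}].
Proof.
move=> uS; have [_ _ af] := sofic_sigma.
(* At least half of the windows are injective, and each window meets at most
   m^2 windows, one for each pair of its positions. *)
pose m := size S; exists (2^-1 / (m * m).+1%:R); first by rewrite divr_gt0.
pose t : R := 2^-1 / (size (enum {: 'I_m * 'I_m})).+1%:R.
have t0 : 0 < t by rewrite divr_gt0.
have := @near_mem _ (enum {: 'I_m * 'I_m}) (fun jj i => jj.1 != jj.2 ->
  few t (fun k => window S i k jj.1 = window S i k jj.2)).
case=> [jj _|N _ NP].
  have [jE|jN] := eqVneq jj.1 jj.2; first by apply: nearW.
  have Sjj : nth 1%g S jj.1 <> nth 1%g S jj.2.
    by apply/eqP; rewrite nth_uniq.
  by apply: filterS (almost_free_near af Sjj t0) => i.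
exists N => // i /(NP i){NP} /= nP.
pose conf k l := [exists j, exists j', window S i k j == window S i l j'].
have conf_sym : symmetric conf.
  by move=> k l; apply/existsP/existsP => -[j /existsP[j' /eqP kl]];
    exists j'; apply/existsP; exists j; rewrite kl.
have conf_card k : (#|[pred l | conf k l]| <= m * m)%N.
  pose r (jj : 'I_m * 'I_m) := sigma i (nth 1%g S jj.2) (window S i k jj.1).
  apply: (@leq_trans #|codom r|).
    apply: subset_leq_card; apply/fintype.subsetP => l.
    rewrite inE => /existsP[j /existsP[j' /eqP kl]].
    by apply/codomP; exists (j, j'); rewrite /r /= kl /window permKV.
  by apply: leq_trans (leq_image_card _ _) _; rewrite card_prod card_ord.
pose D := [set k : 'I_(d i) | injectiveb (window S i k)]%SET.
have [V [VD Vind DV]] := greedy_independent D conf_sym conf_card.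
exists V; split.
- have fewND : few (2^-1 : R) (fun k : 'I_(d i) => k \notin D).
    pose Q (jj : 'I_m * 'I_m) (k : 'I_(d i)) :=
      jj.1 != jj.2 /\ window S i k jj.1 = window S i k jj.2.
    have QD k : k \notin D -> exists2 jj, jj \in enum {: 'I_m * 'I_m} & Q jj k.
      rewrite inE => /injectivePn[j [j' jj' wj]].
      by exists (j, j'); rewrite ?mem_enum.
    apply: (few_sub QD); apply: (@few_le _ _ (t *+ size (enum {: 'I_m * 'I_m}))).
      rewrite -[_ *+ _]mulr_natr /t mulrAC ler_pdivrMr // ler_wpM2l //.
      by rewrite ler_nat.
    apply: few_mem => jj jjE; have [jE|jN] := eqVneq jj.1 jj.2.
      rewrite /few eq_card0 ?mulr_ge0 ?(ltW t0) // => k.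
      by rewrite inE; apply/asboolP => -[/eqP].
    by apply: few_sub (nP jj jjE jN) => k [].
  have dD : (d i)%:R = #|D|%:R + #|[pred k | `[<k \notin D>]]|%:R :> R.
    rewrite -natrD -[in LHS](card_ord (d i)) -(cardC D); congr (_ + _)%N%:R.
    by apply: eq_card => k; rewrite !inE asboolb.
  have DV' : #|D|%:R <= #|V|%:R * (m * m).+1%:R :> R by rewrite -natrM ler_nat.
  rewrite mulrAC ler_pdivrMr //; apply: le_trans DV'.
  by move: fewND dD; rewrite /few; lra.
- by move=> k /(fintype.subsetP VD); rewrite inE => /injectiveP.
- move=> k l kV lV kl j j'; apply: contra (Vind k l kV lV kl) => kjl.
  by apply/existsP; exists j; apply/existsP; exists j'.
Qed.

(** On microstates a forbidden pattern is rarely read along the windows. *)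
Lemma microstate_few_occurs (S : seq G) (y : full_shift G A) (tau : R) :
  (forall x : XT, exists2 s, s \in S & val x s <> y s) -> 0 < tau ->
  exists2 delta : R, 0 < delta & forall i (x : 'I_(d i) -> XT),
    microstate T (symbols X) [set` S] delta (sigma i) x ->
    few tau (fun k => occurs (window S i)
      (fun j => y (nth 1%g S j)) [ffun k => val (x k) 1%g] k).
Proof.
move=> Sy tau0; pose t := tau / (size S).+1%:R.
have t0 : 0 < t by rewrite divr_gt0.
have [|dl dl0 dlP] := @microstate_few R G _ T (symbols X) [set` S] #|A| 2^-1 t _ t0.
  by rewrite invr_gt0.
exists dl => // i x mx.
have fewS s : s \in S -> few t (fun k : 'I_(d i) =>
    val (x k) s <> val (x ((sigma i s)^-1%g k)) 1%g).
  move=> sS; apply: few_sub (dlP _ _ _ _ mx sS) => k xks.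
  apply: symbols_apart; first by rewrite invf_lt1 ?ltr1n.
  by rewrite subshift_coord invgK mulg1.
apply: few_sub (few_le _ (few_mem fewS)); last first.
  rewrite -[_ *+ _]mulr_natr /t mulrAC ler_pdivrMr // ler_wpM2l ?(ltW tau0) //.
  by rewrite ler_nat.
move=> k /forallP kocc; have [s sS xs] := Sy (x k); exists s => // xE.
apply: xs; rewrite xE.
have js : (index s S < size S)%N by rewrite index_mem.
by have /eqP := kocc (Ordinal js); rewrite ffunE /window /= nth_index.
Qed.

Lemma entropy_symbols_lt : X `<` [set: full_shift G A] ->
  (entropy_seq T sigma (symbols X) < (ln (#|A|%:R : R))%:E)%E.
Proof.
move=> properX.
have [y Xy] : exists y, ~ X y.
  apply: contrapT => nX; case: properX => _; apply => y _.
  by apply: contrapT => Xy; apply: nX; exists y.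
have [S0 S0y] := forbidden_pattern closedX Xy.
pose S := undup S0.
have Sy (x : XT) : exists2 s, s \in S & val x s <> y s.
  by have [s sS xs] := S0y x; exists s; rewrite ?mem_undup.
have [c c0 Vnear] := disjoint_windows (undup_uniq S0).
have z1 : expR (-1) < 1 :> R by rewrite expR_lt1 ltrN10.
have z0 : 0 < expR (-1) :> R by exact: expR_gt0.
have A1 : 1 <= #|A|%:R ^+ size S :> R by rewrite -natrX ler1n expn_gt0 A_gt0.
have A0 : 0 < #|A|%:R ^+ size S :> R by apply: lt_le_trans A1.
pose q : R := 1 - (1 - expR (-1)) / #|A|%:R ^+ size S.
have lq : ln q < 0.
  rewrite ln_lt0 // /q; apply/andP; split.
    by rewrite subr_gt0 ltr_pdivrMr // mul1r; lra.
  by rewrite gtrBl divr_gt0 // subr_gt0.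
(* Allowing occurrences at a fraction tau of the indices costs tau per index,
   half of what the disjoint windows save. *)
pose tau := - (c * ln q) / 2.
have tau0 : 0 < tau by rewrite divr_gt0 // oppr_gt0 pmulr_rlt0.
have [dl dl0 dlP] := microstate_few_occurs Sy tau0.
pose L : R := ln #|A|%:R + tau + c * ln q.
apply: (@le_lt_trans _ _ L%:E); last first.
  by rewrite lte_fin /L; move: tau0; rewrite /tau; lra.
apply: ge_ereal_sup => _ [e /= e0 <-].
apply: ge_ereal_inf; eexists.
  exists [set` 1%g :: S] => //.
  by split; [exact: finite_seq|exists 1%g; exact: mem_head].
apply: ge_ereal_inf; eexists; first by exists dl.
apply: limn_esup_le_near.
have [dlim _ _] := sofic_sigma.
have dpos : \forall i \near \oo, (0 < d i)%N.
  by apply: (dlim [set n | (0 < n)%N]); exact: nbhs_infty_gt.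
apply: filterS2 dpos Vnear => i di0 [V [cV Vinj Vdis]].
have dR : 0 < (d i)%:R :> R by rewrite ltr0n.
rewrite muleC lee_pdivrMr // -EFinM.
have [a0 _] : exists a0 : A, a0 \in A by apply/card_gt0P.
pose Hom := approx_hom T (symbols X) [set` 1%g :: S] dl (sigma i).
have [f fP] : {f : (cfun XT R -> 'I_(d i) -> R[i]) -> {ffun 'I_(d i) -> A} &
    forall phi, Hom phi -> exists x, [/\ forall g k, phi g k = g (x k),
      microstate T (symbols X) [set` S] dl (sigma i) x &
      f phi = [ffun k => val (x k) 1%g]]}.
  apply: (@boolp.choice _ _ (fun phi w => Hom phi -> exists x,
    [/\ forall g k, phi g k = g (x k),
      microstate T (symbols X) [set` S] dl (sigma i) x &
      w = [ffun k => val (x k) 1%g]])) => phi.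
  have [hphi|] := pselect (Hom phi); last by exists [ffun=> a0].
  have [x phix mx] := approx_hom_points (compact_subshift closedX) hphi.
  exists [ffun k => val (x k) 1%g] => _; exists x; split=> //.
  by apply: microstate_le mx => // s /= sS; rewrite inE sS orbT.
pose W := [pred w : {ffun 'I_(d i) -> A} | #|[pred k | occurs (window S i)
  (fun j => y (nth 1%g S j)) w k]|%:R <= tau * (d i)%:R].
have NW : (Nsep e Hom (rho_seq (symbols X)) <= #|W|%:R%:E)%E.
  apply: (@Nsep_le_card _ _ _ _ f).
    move=> phi /fP[x [_ mx ->]]; rewrite /W /=.
    have := dlP i x mx; rewrite /few; congr (_%:R <= _).
    by apply: eq_card => k; rewrite !inE asboolb.
  move=> phi psi /fP[x [phix _ ->]] /fP[x' [psix _ ->]].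
  rewrite (rho_seq_eval _ phix psix) => + /ffunP xx'.
  rewrite pdist0 ?lte_fin ?ltNge ?(ltW e0) // => n k.
  by apply: symbols_local; have := xx' k; rewrite !ffunE.
have WL : #|W|%:R <= expR ((d i)%:R * L).
  have := @card_few_occurs R 'I_(d i) A (size S) (window S i)
    (fun j => y (nth 1%g S j)) tau c V A_gt0 _ Vinj Vdis.
  by rewrite !card_ord => /(_ cV).
have NL : (Nsep e Hom (rho_seq (symbols X)) <= (expR ((d i)%:R * L))%:E)%E.
  by apply: le_trans NW _; rewrite lee_fin.
apply: le_trans (le_lne NL) _.
by rewrite lne_EFin ?expR_gt0 // expRK mulrC.
Qed.

End Bound.

Theorem theorem4p12 (R : realType) (G : groupType)
  (countable_G : countable [set: G]) (sofic_G : sofic G R)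
  (d : nat -> nat) (sigma : forall i, G -> 'S_(d i))
  (sofic_sigma : sofic_approximation R sigma)
  (A : finType) (nonempty_A : (0 < #|A|)%N)
  (X : set (full_shift G A)) (closed_X : closed X)
  (invariant_X : shift_invariant X) (proper_X : X `<` [set: full_shift G A]) :
  (topological_entropy (R := R) (subshift invariant_X) sigma
     < (ln (#|A|%:R : R))%:E)%E.
Proof.
rewrite (topological_entropyE (compact_subshift closed_X) sofic_sigma
  (symbols_generator (R := R) invariant_X closed_X)).
exact: entropy_symbols_lt.
Qed.
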